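(* Let $A$ be an asymmetric fuzzy number, $\Omega\subseteq\mathbb{R}^n$ open, $k\in\mathbb{N}$ and $1\le p<\infty$. Consider the spaces $(W^{k,p}(\Omega,\mathbb{C}_{\mathcal{F}(A)}),\|\cdot\|_{\tilde p,k})$ and $(W^{k,p}(\Omega,\mathbb{C})\times W^{k,p}(\Omega,\mathbb{C}),\|\cdot\|_{m-p,k})$, where $$\|(u,v)\|_{m-p,k}:=\sum_{|\alpha|\le k}\max\{\|D^\alpha u\|_p,\|D^\alpha v\|_p\}.$$ Let $\Psi:W^{k,p}(\Omega,\mathbb{C}_{\mathcal{F}(A)})\to W^{k,p}(\Omega,\mathbb{C})\times W^{k,p}(\Omega,\mathbb{C})$ be the mapping given by $F=u+vA\mapsto\Psi(F)=(u,v)$. The operator $\Psi$ is a linear homeomorphism, that is, $\Psi$ is linear and bijective and both $\Psi$ and $\Psi^{-1}$ are continuous. Consequently, the fuzzy Sobolev space $(W^{k,p}(\Omega,\mathbb{C}_{\mathcal{F}(A)}),\|\cdot\|_{\tilde p,k})$ is isomorphic as a vector space and homeomorphic as a normed space to $W^{k,p}(\Omega,\mathbb{C})\times W^{k,p}(\Omega,\mathbb{C})$.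
   Context: A fuzzy number is a function $A:\mathbb{R}\to[0,1]$ whose level sets $[A]_\alpha=\{x: A(x)\ge\alpha\}$ ($0<\alpha\le1$) and $[A]_0=\overline{\{x:A(x)>0\}}$ are all nonempty closed bounded intervals; sums and real multiples of fuzzy numbers are taken level-wise, and real numbers are identified with singletons. A complex fuzzy number is an expression $C+iD$ with $C,D$ fuzzy numbers. $A$ is asymmetric if for every $y\in\mathbb{R}$ there is $x_0\in\mathbb{R}$ with $A(y-x_0)\ne A(y+x_0)$. For $u,v\in\mathbb{C}$ put $u+vA:=(\mathrm{Re}\,u+(\mathrm{Re}\,v)A)+i(\mathrm{Im}\,u+(\mathrm{Im}\,v)A)$ and $\mathbb{C}_{\mathcal{F}(A)}:=\{u+vA: u,v\in\mathbb{C}\}$. For asymmetric $A$ the map $\psi(u,v)=u+vA$ is a bijection $\mathbb{C}^2\to\mathbb{C}_{\mathcal{F}(A)}$, and $\mathbb{C}_{\mathcal{F}(A)}$ is a two-dimensional complex vector space with operations transported by $\psi$: $(u+vA)\oplus(z+wA)=(u+z)+(v+w)A$, $\lambda(u+vA)=\lambda u+\lambda vA$. Operations on functions with values in $\mathbb{C}_{\mathcal{F}(A)}$ are pointwise, and each function $F:\Omega\to\mathbb{C}_{\mathcal{F}(A)}$ is written uniquely as $F=u+vA$ with $u,v:\Omega\to\mathbb{C}$. Let $m(A)$ be the midpoint of the interval $[A]_1$. The $A$-cross product is $(u+vA)\odot(z+wA)=(uz-m(A)^2vw)+(uw+zv+2m(A)vw)A$. On $\mathbb{C}_{\mathcal{F}(A)}$,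 $\|u+vA\|_{\tilde p}=(|u+m(A)v|^p+|v|^p)^{1/p}$. $F=u+vA$ is integrable on a set if $u$ and $v$ are, and then $\int F=\int u+(\int v)A$. $L^p(\Omega,\mathbb{C}_{\mathcal{F}(A)})$ is the set of (measurable) $F:\Omega\to\mathbb{C}_{\mathcal{F}(A)}$ with $\|F\|_{\tilde p}:=\bigl(\int_\Omega\|F(\omega)\|_{\tilde p}^p\,d\omega\bigr)^{1/p}<\infty$ (functions equal a.e. identified); $L^1_{\mathrm{loc}}(\Omega,\mathbb{C}_{\mathcal{F}(A)})$ is the set of functions integrable on every compact subset of $\Omega$; $C_c^\infty(\Omega,\mathbb{C}_{\mathcal{F}(A)})$ is the set of infinitely differentiable functions with compact support in $\Omega$. For $\alpha\in\mathbb{N}_0^n$, $|\alpha|=\sum_i\alpha_i$, and $F,G\in L^1_{\mathrm{loc}}(\Omega,\mathbb{C}_{\mathcal{F}(A)})$, $G$ is the $\alpha^{th}$-weak partial derivative of $F$, written $G=D^\alpha F$, if for all $\Phi\in C_c^\infty(\Omega,\mathbb{C}_{\mathcal{F}(A)})$, $$\int_\Omega F(\omega)\odot D^\alpha\Phi(\omega)\,d\omega=(-1)^{|\alpha|}\int_\Omega G(\omega)\odot\Phi(\omega)\,d\omega.$$ $W^{k,p}(\Omega,\mathbb{C}_{\mathcal{F}(A)})$ is the set of $F\in L^p(\Omega,\mathbb{C}_{\mathcal{F}(A)})$ having weak derivatives $D^\alpha F\in L^p(\Omega,\mathbb{C}_{\mathcal{F}(A)})$ for all $|\alpha|\le k$,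 with norm $\|F\|_{\tilde p,k}=\sum_{|\alpha|\le k}\|D^\alpha F\|_{\tilde p}$. $W^{k,p}(\Omega,\mathbb{C})$ is the classical Sobolev space, $D^\alpha u$ the classical weak derivative, and $\|\cdot\|_p$ the norm of $L^p(\Omega,\mathbb{C})$. *)

(* Defs.v *)
From HB Require Import structures.
From mathcomp Require Import all_boot all_order all_algebra generic_quotient.
From mathcomp Require Import all_classical all_reals all_analysis.
From mathcomp Require Import complex lra.

Set Implicit Arguments.
Unset Strict Implicit.
Unset Printing Implicit Defensive.
Import Order.TTheory GRing.Theory Num.Theory.
Import numFieldNormedType.Exports.
Local Open Scope classical_set_scope.
Local Open Scope ring_scope.

Ltac dlra := repeat match goal with
  | H : is_true (_ && _) |- _ => let H1 := fresh in let H2 := fresh in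
      move/andP: H => [H1 H2] end;
  try (apply/andP; split); lra.

Section Levels.
Context {R : realType}.
Implicit Types (f : R -> R) (L : R -> set R) (al be : R).

Definition level f al : set R :=
  if al == 0 then closure [set x | 0 < f x] else [set x | al <= f x].

Definition of_levels L (x : R) : R := sup [set al | 0 < al <= 1 /\ L al x].

Definition is_level_family L := [/\
  forall al, 0 <= al <= 1 -> exists a b, a <= b /\ L al = `[a, b]%classic,
  forall al be, 0 < al -> al <= be -> be <= 1 -> L be `<=` L al,
  forall al x, 0 < al <= 1 ->
    (forall be, 0 < be < al -> L be x) -> L al x &
  L 0 = closure [set x | exists2 al, 0 < al <= 1 & L al x]].

Lemma of_levels_ub L x al : 0 < al <= 1 -> L al x -> al <= of_levels L x.
Proof.
move=> al01 Lx; apply: sup_upper_bound; last by split.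
by split; [exists al; split|exists 1 => b /= [/andP[]]].
Qed.

Lemma of_levels01 L x : 0 <= of_levels L x <= 1.
Proof.
have [E0|E0] := pselect ([set al | 0 < al <= 1 /\ L al x] !=set0); last first.
  rewrite /of_levels (_ : [set _ | _] = set0) ?sup0 ?lexx ?ler01//.
  by apply/seteqP; split => // al Lal; apply: E0; exists al.
apply/andP; split.
  case: E0 => al [al01 Lx]; apply: le_trans (of_levels_ub al01 Lx).
  by case/andP: al01 => /ltW.
by apply: ge_sup => // al [/andP[]].
Qed.

Lemma of_levels_lt L x al : 0 <= al -> al < of_levels L x ->
  exists be, [/\ al < be, be <= 1 & L be x].
Proof.
move=> al0 alx.
have E0 : [set al | 0 < al <= 1 /\ L al x] !=set0.
  apply: contrapT => E0; move: alx; rewrite /of_levels (_ : [set _ | _] = set0).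
    by rewrite sup0 ltNge al0.
  by apply/seteqP; split => // be Lbe; apply: E0; exists be.
have hs : has_sup [set al | 0 < al <= 1 /\ L al x].
  by split => //; exists 1 => b /= [/andP[]].
have d0 : 0 < of_levels L x - al by rewrite subr_gt0.
have [be [/andP[be0 be1] Lbe]] := sup_adherent d0 hs.
by rewrite -/(of_levels L x) subKr => albe; exists be.
Qed.

(* The Negoita-Ralescu representation theorem. *)
Lemma level_of_levels L al : is_level_family L -> 0 <= al <= 1 ->
  level (of_levels L) al = L al.
Proof.
move=> [_ Lanti Llc L0] /andP[al0 al1]; rewrite /level.
have [->|aln0] := eqVneq al 0.
  rewrite L0; congr closure; apply/seteqP; split => x /=.
    by move=> /(of_levels_lt (lexx _))[be [be0 be1 Lx]]; exists be => //; rewrite be0.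
  move=> [be /andP[be0 be1] Lx]; apply: (lt_le_trans be0).
  by apply: of_levels_ub Lx; rewrite be0.
have {aln0} {}al0 : 0 < al by rewrite lt_neqAle eq_sym aln0.
apply/seteqP; split => x /= Lx; last by apply: of_levels_ub; rewrite ?al0.
apply: Llc; first by rewrite al0.
move=> be /andP[be0 beal].
have [ga [ga1 ga2 Lga]] := of_levels_lt (ltW be0) (lt_le_trans beal Lx).
exact: (Lanti _ _ be0 (ltW ga1)).
Qed.

End Levels.

(* [level] at height 0 is the closure of the support. *)
Record fuzzy_number (R : realType) := FuzzyNumber {
  fuzzy_fun :> R -> R;
  fuzzy_fun01 : forall x, 0 <= fuzzy_fun x <= 1;
  fuzzy_levelE : forall al, 0 <= al <= 1 ->
    exists a b, a <= b /\ level fuzzy_fun al = `[a, b]%classic }.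

Section FuzzyOps.
Context {R : realType}.
Implicit Types (A B : fuzzy_number R) (c r : R).

Lemma fuzzy_eqP A B : A =1 B -> A = B.
Proof.
case: A B => f f01 fl [g g01 gl] /= /funext fg; case: _ / fg in g01 gl *.
by congr FuzzyNumber; exact: Prop_irrelevance.
Qed.

Lemma level_family A : is_level_family (level A).
Proof.
split; first exact: fuzzy_levelE.
- move=> al be al0 albe _ x; rewrite /level (gt_eqF al0) (gt_eqF (lt_le_trans al0 albe))/=.
  exact: le_trans.
- move=> al x /andP[al0 _]; rewrite /level gt_eqF//= => h.
  rewrite leNgt; apply/negP => Ax.
  have [Ax0 _] := andP (fuzzy_fun01 A x).
  have /h : 0 < (A x + al) / 2 < al by dlra.
  by rewrite gt_eqF/=; dlra.
- rewrite /level eqxx; congr closure; apply/seteqP; split => x /=.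
    move=> Ax; exists (A x); last by rewrite gt_eqF/=.
    by rewrite Ax; case/andP: (fuzzy_fun01 A x).
  by move=> [al /andP[al0 _]]; rewrite gt_eqF//=; exact: lt_le_trans.
Qed.

Lemma closure_ltP (S : set R) x :
  closure S x <-> forall e, 0 < e -> exists2 y, S y & `|x - y| < e.
Proof.
split => [cSx e e0|h B /nbhs_ballP[e /= e0 eB]].
  by have [y [Sy /= xy]] := cSx _ (nbhsx_ballx x e e0); exists y.
by have [y Sy xy] := h e e0; exists y; split => //; exact: eB.
Qed.

Definition add_levels A B al : set R :=
  [set x + y | x in level A al & y in level B al].

Definition scale_levels c A al : set R := [set c * x | x in level A al].

Lemma add_levels_itv (a b c d : R) : a <= b -> c <= d ->
  [set x + y | x in `[a, b]%classic & y in `[c, d]%classic] =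
  `[a + c, b + d]%classic.
Proof.
move=> ab cd; apply/seteqP; split => [z /= [x + [y + <-]]|z /=].
  by rewrite !in_itv/= => /andP[? ?] /andP[? ?]; apply/andP; split; exact: lerD.
rewrite in_itv/= => /andP[z1 z2].
have [zbc|bcz] := leP z (b + c).
  exists (z - c); first by rewrite /= in_itv/=; dlra.
  by exists c; [rewrite /= in_itv/=; dlra|rewrite subrK].
exists b; first by rewrite /= in_itv/= ab lexx.
by exists (z - b); [rewrite /= in_itv/=; dlra|rewrite subrKC].
Qed.

Lemma add_levels_family A B : is_level_family (add_levels A B).
Proof.
have [Ai Aa Al A0] := level_family A; have [Bi Ba Bl B0] := level_family B.
have itvAB al : 0 <= al <= 1 ->
    exists a b c d, [/\ a <= b, c <= d, level A al = `[a, b]%classic,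
      level B al = `[c, d]%classic & add_levels A B al = `[a + c, b + d]%classic].
  move=> al01; have [a [b [ab Aab]]] := Ai _ al01.
  have [c [d [cd Bcd]]] := Bi _ al01; exists a, b, c, d; split => //.
  by rewrite /add_levels Aab Bcd add_levels_itv.
split.
- move=> al /itvAB[a [b [c [d [ab cd _ _ ->]]]]].
  by exists (a + c), (b + d); rewrite lerD.
- move=> al be al0 albe be1 _ [x Ax [y By <-]].
  exists x; first exact: Aa Ax.
  by exists y => //; exact: Ba By.
- move=> al x /andP[al0 al1] h.
  have [|a [b [c [d [ab cd Aab Bcd ->]]]]] := itvAB al; first by rewrite al1 ltW.
  (* a point outside level F al already lies outside some lower level *)
  have esc (F : fuzzy_number R) t : ~ level F al t ->
      exists2 be, 0 < be < al & forall ga, be <= ga -> ga <= 1 -> ~ level F ga t.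
    move=> nFt; have [_ Fa Fl _] := level_family F.
    apply: contrapT => nex; apply: nFt; apply: Fl; first by rewrite al0.
    move=> be be0; apply: contrapT => nFbe; apply: nex; exists be => // ga bega ga1 Fga.
    by apply: nFbe; apply: Fa Fga; rewrite //; case/andP: be0.
  rewrite /= in_itv/=; apply/andP; split; rewrite leNgt; apply/negP => xlt.
  + pose e := (a + c - x) / 2.
    have [|be1 be1a hA] := esc A (a - e).
      by rewrite Aab /= in_itv/= /e; dlra.
    have [|be2 be2a hB] := esc B (c - e).
      by rewrite Bcd /= in_itv/= /e; dlra.
    pose ga := Num.max be1 be2.
    have ga0 : 0 < ga < al by rewrite /ga lt_max gt_max; case/andP: be1a => -> ->; case/andP: be2a => _ ->.
    have ga1 : ga <= 1 by dlra.
    have [y Ay [z Bz yz]] := h _ ga0.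
    have := hA _ _ ga1; have := hB _ _ ga1.
    rewrite /ga !le_max !lexx ?orbT -/ga => /(_ isT) hB' /(_ isT) hA'.
    have [|a' [b' [c' [d' [_ _ Aab' Bcd' _]]]]] := itvAB ga; first by dlra.
    have Aa' : level A ga a.
      by apply: (Aa _ al) => //; [dlra|dlra|rewrite Aab /= in_itv/= lexx ab].
    have Bc' : level B ga c.
      by apply: (Ba _ al) => //; [dlra|dlra|rewrite Bcd /= in_itv/= lexx cd].
    move: hA' hB' Ay Bz Aa' Bc'.
    rewrite Aab' Bcd' /= !in_itv/= /e => hA' hB' Ay Bz Aa' Bc'.
    have : a - e < a' by rewrite ltNge; apply/negP => q; apply: hA'; rewrite /e in q *; dlra.
    have : c - e < c' by rewrite ltNge; apply/negP => q; apply: hB'; rewrite /e in q *; dlra.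
    by rewrite /e; dlra.
  + pose e := (x - (b + d)) / 2.
    have [|be1 be1a hA] := esc A (b + e).
      by rewrite Aab /= in_itv/= /e; dlra.
    have [|be2 be2a hB] := esc B (d + e).
      by rewrite Bcd /= in_itv/= /e; dlra.
    pose ga := Num.max be1 be2.
    have ga0 : 0 < ga < al by rewrite /ga lt_max gt_max; case/andP: be1a => -> ->; case/andP: be2a => _ ->.
    have ga1 : ga <= 1 by dlra.
    have [y Ay [z Bz yz]] := h _ ga0.
    have := hA _ _ ga1; have := hB _ _ ga1.
    rewrite /ga !le_max !lexx ?orbT -/ga => /(_ isT) hB' /(_ isT) hA'.
    have [|a' [b' [c' [d' [_ _ Aab' Bcd' _]]]]] := itvAB ga; first by dlra.
    have Aa' : level A ga b.
      by apply: (Aa _ al) => //; [dlra|dlra|rewrite Aab /= in_itv/= lexx ab].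
    have Bc' : level B ga d.
      by apply: (Ba _ al) => //; [dlra|dlra|rewrite Bcd /= in_itv/= lexx cd].
    move: hA' hB' Ay Bz Aa' Bc'.
    rewrite Aab' Bcd' /= !in_itv/= /e => hA' hB' Ay Bz Aa' Bc'.
    have : b' < b + e by rewrite ltNge; apply/negP => q; apply: hA'; rewrite /e in q *; dlra.
    have : d' < d + e by rewrite ltNge; apply/negP => q; apply: hB'; rewrite /e in q *; dlra.
    by rewrite /e; dlra.
- apply/seteqP; split => x; last first.
    have [|a [b [c [d [ab cd Aab Bcd E]]]]] := itvAB 0; first by rewrite lexx ler01.
    have -> : add_levels A B 0 = closure (add_levels A B 0).
      by apply/closure_id; rewrite E; exact: interval_closed.
    apply: closure_subset => y [al al01 [s As [t Bt <-]]].
    exists s; first by rewrite A0; apply: subset_closure; exists al.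
    by exists t => //; rewrite B0; apply: subset_closure; exists al.
  move=> [s + [t + <-]]; rewrite A0 B0 => /closure_ltP hs /closure_ltP ht.
  apply/closure_ltP => e e0.
  have [|s' [al al01 As'] ss'] := hs (e / 2); first by rewrite divr_gt0.
  have [|t' [be be01 Bt'] tt'] := ht (e / 2); first by rewrite divr_gt0.
  have [al0 al1] := andP al01; have [be0 be1] := andP be01.
  exists (s' + t'); last first.
    rewrite opprD addrACA; apply: le_lt_trans (ler_normD _ _) _; dlra.
  have m0 : 0 < Num.min al be by rewrite lt_min al0.
  exists (Num.min al be); first by rewrite m0 ge_min al1.
  exists s'; first by apply: (Aa _ al); rewrite // ge_min lexx.
  by exists t' => //; apply: (Ba _ be); rewrite // ge_min lexx orbT.
Qed.

Lemma scale_levels_itv c (a b : R) : a <= b -> exists a' b', a' <= b' /\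
  [set c * x | x in `[a, b]%classic] = `[a', b']%classic.
Proof.
move=> ab; have [c0|c0|->] := ltgtP c 0.
- exists (c * b), (c * a); split; first by rewrite ler_wnM2l// ltW.
  apply/seteqP; split => [_ /= [x + <-]|x /=]; rewrite !in_itv/=.
    by move=> /andP[? ?]; rewrite !ler_nM2l//; apply/andP.
  move=> /andP[xa xb]; exists (c^-1 * x); last by rewrite mulVKf// lt_eqF.
  by rewrite /= in_itv/= ![c^-1 * _]mulrC ler_ndivlMr// ler_ndivrMr// ![_ * c]mulrC xa xb.
- exists (c * a), (c * b); split; first by rewrite ler_wpM2l// ltW.
  apply/seteqP; split => [_ /= [x + <-]|x /=]; rewrite !in_itv/=.
    by move=> /andP[? ?]; rewrite !ler_pM2l//; apply/andP.
  move=> /andP[xa xb]; exists (c^-1 * x); last by rewrite mulVKf// gt_eqF.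
  by rewrite /= in_itv/= ![c^-1 * _]mulrC ler_pdivlMr// ler_pdivrMr// ![_ * c]mulrC xa xb.
- exists 0, 0; split => //; rewrite set_itv1.
  apply/seteqP; split => [_ /= [x _ <-]|_ -> /=]; first by rewrite mul0r.
  by exists a; rewrite ?mul0r//= in_itv/= lexx.
Qed.

Lemma scale_levels_family c A : is_level_family (scale_levels c A).
Proof.
have [Ai Aa Al A0] := level_family A.
have Aitv al : 0 <= al <= 1 ->
    exists a b, a <= b /\ scale_levels c A al = `[a, b]%classic.
  by move=> /Ai[a [b [ab E]]]; rewrite /scale_levels E; exact: scale_levels_itv.
split => //.
- by move=> al be al0 albe be1; apply: image_subset; exact: Aa.
- move=> al x al01 h; have [c0|c0] := eqVneq c 0.
    have [|y Ay xy] := h (al / 2); first by dlra.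
    have [|a [b [ab E]]] := Ai al; first by dlra.
    exists a; last by rewrite -xy c0 !mul0r.
    by rewrite E /= in_itv/= lexx.
  exists (c^-1 * x); last by rewrite mulVKf.
  by apply: Al => // be /h[y Ay <-]; rewrite mulKf.
- apply/seteqP; split => x; last first.
    have [|a [b [ab E]]] := Aitv 0; first by rewrite lexx ler01.
    have -> : scale_levels c A 0 = closure (scale_levels c A 0).
      by apply/closure_id; rewrite E; exact: interval_closed.
    apply: closure_subset => _ [al al01 [s As <-]].
    by exists s => //; rewrite A0; apply: subset_closure; exists al.
  move=> [s + <-]; rewrite A0 => /closure_ltP hs.
  apply/closure_ltP => e e0.
  have c1 : 0 < `|c| + 1 by rewrite ltr_wpDl.
  have [|s' [al al01 As'] ss'] := hs (e / (`|c| + 1)); first by rewrite divr_gt0.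
  exists (c * s'); first by exists al => //; exists s'.
  rewrite -mulrBr normrM; move: ss'; rewrite ltr_pdivlMr// => ss'.
  by have := normr_ge0 (s - s'); dlra.
Qed.

Lemma of_levels_fuzzy (L : R -> set R) : is_level_family L ->
  forall al, 0 <= al <= 1 ->
  exists a b, a <= b /\ level (of_levels L) al = `[a, b]%classic.
Proof. by move=> FL al al01; rewrite level_of_levels//; case: FL => + _ _ _; apply. Qed.

Definition fuzzy_add A B : fuzzy_number R :=
  FuzzyNumber (of_levels01 (add_levels A B))
    (of_levels_fuzzy (add_levels_family A B)).

Definition fuzzy_scale c A : fuzzy_number R :=
  FuzzyNumber (of_levels01 (scale_levels c A))
    (of_levels_fuzzy (scale_levels_family c A)).

Lemma level_fuzzy_add A B al : 0 <= al <= 1 ->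
  level (fuzzy_add A B) al = [set x + y | x in level A al & y in level B al].
Proof. by move=> al01; apply: level_of_levels => //; exact: add_levels_family. Qed.

Lemma level_fuzzy_scale c A al : 0 <= al <= 1 ->
  level (fuzzy_scale c A) al = [set c * x | x in level A al].
Proof. by move=> al01; apply: level_of_levels => //; exact: scale_levels_family. Qed.

(* The real number r as a fuzzy number. *)
Definition crisp r : R -> R := fun x => (x == r)%:R.

Lemma crisp01 r x : 0 <= crisp r x <= 1.
Proof. by rewrite /crisp; case: eqP; rewrite ?lexx ler01. Qed.

Lemma level_crisp r al : 0 <= al <= 1 -> level (crisp r) al = [set r].
Proof.
move=> /andP[al0 al1]; rewrite /level /crisp; case: eqVneq => [_|aln0].
  rewrite (_ : [set x | _] = [set r]); first by apply/esym/closure_id/closed_eq.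
  by apply/seteqP; split => x /=; case: eqP => //= _; rewrite ?ltxx ?ltr01.
have {}al0 : 0 < al by rewrite lt_neqAle eq_sym aln0.
apply/seteqP; split => x /=; case: eqP => //= _.
by move=> /(lt_le_trans al0); rewrite ltxx.
Qed.

Lemma crisp_fuzzy r al : 0 <= al <= 1 ->
  exists a b, a <= b /\ level (crisp r) al = `[a, b]%classic.
Proof. by move=> al01; exists r, r; rewrite lexx level_crisp// set_itv1. Qed.

Definition fuzzy_real r : fuzzy_number R := FuzzyNumber (crisp01 r) (@crisp_fuzzy r).

Definition asymmetric A := forall y : R, exists x0 : R, A (y - x0) <> A (y + x0).

Definition midpoint A : R := (inf (level A 1) + sup (level A 1)) / 2.

Definition affine_fuzzy (r c : R) A := fuzzy_add (fuzzy_real r) (fuzzy_scale c A).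

Lemma level_affine_fuzzy r c A al : 0 <= al <= 1 ->
  level (affine_fuzzy r c A) al = [set r + c * x | x in level A al].
Proof.
move=> al01; rewrite level_fuzzy_add// level_fuzzy_scale// level_crisp//.
apply/seteqP; split => [_ [_ -> [_ [x Ax <-] <-]]|_ [x Ax <-]]; first by exists x.
by exists r => //; exists (c * x) => //; exists x.
Qed.

Lemma level_affine_itv r c A al a b : 0 <= al <= 1 -> a <= b ->
  level A al = `[a, b]%classic ->
  forall x, level (affine_fuzzy r c A) al x ->
    (0 <= c -> r + c * a <= x <= r + c * b) /\ (c <= 0 -> r + c * b <= x <= r + c * a).
Proof.
move=> al01 ab E x; rewrite level_affine_fuzzy// E => -[y + <-].
rewrite /= in_itv/= => /andP[ay yb]; split => c0; rewrite !lerD2l.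
  by rewrite !ler_wpM2l.
by rewrite !ler_wnM2l.
Qed.

Lemma level_inj (A B : fuzzy_number R) :
  (forall al, 0 < al <= 1 -> level A al = level B al) -> A = B.
Proof.
have le (F G : fuzzy_number R) x :
    (forall al, 0 < al <= 1 -> level F al = level G al) -> F x <= G x.
  move=> FG; have [/andP[F0 F1] /andP[G0 G1]] := (fuzzy_fun01 F x, fuzzy_fun01 G x).
  have [->//|Fn0] := eqVneq (F x) 0.
  have {}F0 : 0 < F x by rewrite lt_neqAle eq_sym Fn0.
  have := FG (F x); rewrite F0 F1 => /(_ isT) /seteqP[+ _].
  by move=> /(_ x); rewrite /level (negbTE Fn0)/=; apply.
move=> AB; apply: fuzzy_eqP => x; apply/eqP; rewrite eq_le !le// => al al01.
by rewrite AB.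
Qed.

Lemma affine_fuzzy_inj A : asymmetric A -> forall r c r' c',
  affine_fuzzy r c A = affine_fuzzy r' c' A -> r = r' /\ c = c'.
Proof.
move=> asA r c r' c' E.
have Ai := @fuzzy_levelE _ A.
have mem1 : forall p q al a b, 0 <= al <= 1 -> a <= b -> level A al = `[a, b]%classic ->
    level (affine_fuzzy p q A) al (p + q * a) /\ level (affine_fuzzy p q A) al (p + q * b).
  move=> p q al a b al01 ab Eab; rewrite level_affine_fuzzy// Eab.
  by split; [exists a|exists b] => //=; rewrite in_itv/= lexx ab.
have key al a b : 0 <= al <= 1 -> a <= b -> level A al = `[a, b]%classic ->
   (r + c * a = r' + c' * a /\ r + c * b = r' + c' * b) \/
   (r + c * a = r' + c' * b /\ r + c * b = r' + c' * a).
  move=> al01 ab Eab.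
  have [h1 h2] := mem1 r c _ _ _ al01 ab Eab.
  have [h3 h4] := mem1 r' c' _ _ _ al01 ab Eab.
  rewrite E in h1 h2; rewrite -E in h3 h4.
  have [h1p h1n] := level_affine_itv al01 ab Eab h1.
  have [h2p h2n] := level_affine_itv al01 ab Eab h2.
  have [h3p h3n] := level_affine_itv al01 ab Eab h3.
  have [h4p h4n] := level_affine_itv al01 ab Eab h4.
  have [c0|/ltW c0] := leP 0 c; have [c0'|/ltW c0'] := leP 0 c';
    (try (have {}h1p := h1p c0')); (try (have {}h2p := h2p c0'));
    (try (have {}h1n := h1n c0')); (try (have {}h2n := h2n c0'));
    (try (have {}h3p := h3p c0)); (try (have {}h4p := h4p c0));
    (try (have {}h3n := h3n c0)); (try (have {}h4n := h4n c0));
    [left|right|right|left]; split; dlra.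
have [cc|ncc] := eqVneq c c'.
  split => //; have [|a [b [ab Eab]]] := Ai 1; first by rewrite ler01 lexx.
  by subst c'; case: (key _ _ _ _ ab Eab); rewrite ?ler01 ?lexx//; dlra.
exfalso.
(* otherwise every level of A is centred at y, so A is symmetric about y *)
have [y hy] : exists y, forall al a b, 0 <= al <= 1 -> a <= b ->
    level A al = `[a, b]%classic -> a + b = y + y.
  have dcc : c - c' != 0 by rewrite subr_eq0.
  exists ((r' - r) / (c - c')); set y := _ / _.
  have yE : (c - c') * y = r' - r by rewrite mulrC divfK.
  move=> al a b al01 ab Eab; apply: (mulfI dcc).
  have [cc0|nc0] := eqVneq (c + c') 0.
    have c'E : c' = - c by apply/eqP; rewrite -addr_eq0 addrC cc0.
    rewrite c'E in yE *.
    by case: (key _ _ _ al01 ab Eab) => -[]; rewrite c'E => k1 k2; lra.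
  case: (key _ _ _ al01 ab Eab) => -[k1 k2]; first by lra.
  have ba : a = b by apply: (mulfI nc0); lra.
  by rewrite ba in k1 *; lra.
have [x0] := asA y; apply.
suff sym (x : R) : A (y - x) <= A (y + x).
  by apply/eqP; rewrite eq_le sym/=; have := sym (- x0); rewrite opprK.
have /andP[A0 A1] := fuzzy_fun01 A (y - x).
have [->|An0] := eqVneq (A (y - x)) 0; first by case/andP: (fuzzy_fun01 A (y + x)).
have al01 : 0 <= A (y - x) <= 1 by rewrite A0.
have [a [b [ab Eab]]] := Ai _ al01.
have := hy _ _ _ al01 ab Eab => aby.
have : level A (A (y - x)) (y - x) by rewrite /level (negbTE An0)/=.
rewrite Eab /= in_itv/= => yx.
have : level A (A (y - x)) (y + x) by rewrite Eab /= in_itv/=; dlra.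
by rewrite /level (negbTE An0).
Qed.

End FuzzyOps.

Local Open Scope complex_scope.
Import Normc.

(* C + iD is encoded as (C, D). *)
Definition complex_fuzzy (R : realType) := (fuzzy_number R * fuzzy_number R)%type.

(* u + vA *)
Definition uvA_val (R : realType) (A : fuzzy_number R) (u v : R[i]) : complex_fuzzy R :=
  (affine_fuzzy (complex.Re u) (complex.Re v) A, affine_fuzzy (complex.Im u) (complex.Im v) A).

(* The asymmetry proof is a phantom parameter: the vector space operations,
   transported from pairs (u, v), are lawful only when u + vA determines u and v. *)
Definition CFA (R : realType) (A : fuzzy_number R) (hA : asymmetric A) : Type :=
  {z : complex_fuzzy R | exists uv : R[i] * R[i], z = uvA_val A uv.1 uv.2}.

Section CFA_lmodType.
Context {R : realType} {A : fuzzy_number R} {hA : asymmetric A}.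
Implicit Types (x y z : CFA hA) (uv : R[i] * R[i]) (l : R[i]).

HB.instance Definition _ := gen_eqMixin (CFA hA).
HB.instance Definition _ := gen_choiceMixin (CFA hA).

Definition psi uv : CFA hA := exist _ (uvA_val A uv.1 uv.2) (ex_intro _ uv erefl).

Definition psi_inv x : R[i] * R[i] := projT1 (cid (proj2_sig x)).

Lemma psi_invK : cancel psi_inv psi.
Proof.
case=> z hz; rewrite /psi_inv /=; case: cid => uv /= E.
by subst z; congr exist; exact: Prop_irrelevance.
Qed.

Lemma psi_inj : injective psi.
Proof.
move=> [[a b] [c d]] [[a' b'] [c' d']] /(congr1 (@proj1_sig _ _)) E.
have h1 := congr1 fst E; have h2 := congr1 snd E.
by have /= [-> ->] := affine_fuzzy_inj hA h1; have /= [-> ->] := affine_fuzzy_inj hA h2.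
Qed.

Lemma psiK : cancel psi psi_inv.
Proof. by move=> uv; apply: psi_inj; rewrite psi_invK. Qed.

Let zero := psi 0.
Let opp x := psi (- psi_inv x).
Let add x y := psi (psi_inv x + psi_inv y).
Let scale l x := psi (l *: psi_inv x).

Let addA : associative add.
Proof. by move=> x y z; rewrite /add !psiK addrA. Qed.
Let addC : commutative add.
Proof. by move=> x y; rewrite /add addrC. Qed.
Let add0 : left_id zero add.
Proof. by move=> x; rewrite /add psiK add0r psi_invK. Qed.
Let addN : left_inverse zero opp add.
Proof. by move=> x; rewrite /add psiK addNr. Qed.

HB.instance Definition _ := GRing.isZmodule.Build (CFA hA) addA addC add0 addN.

Let addE x y : x + y = psi (psi_inv x + psi_inv y). Proof. by []. Qed.
Let scaleA l m x : scale l (scale m x) = scale (l * m) x.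
Proof. by rewrite /scale psiK scalerA. Qed.
Let scale1 : left_id 1 scale.
Proof. by move=> x; rewrite /scale scale1r psi_invK. Qed.
Let scaleDr : right_distributive scale +%R.
Proof. by move=> l x y; rewrite /scale !addE !psiK scalerDr. Qed.
Let scaleDl x : {morph scale^~ x : l m / l + m}.
Proof. by move=> l m; rewrite /scale addE !psiK scalerDl. Qed.

HB.instance Definition _ :=
  GRing.Zmodule_isLmodule.Build R[i] (CFA hA) scaleA scale1 scaleDr scaleDl.

Lemma psiD : {morph psi : s t / s + t}.
Proof. by move=> s t; rewrite addE !psiK. Qed.
Lemma psiZ l : {morph psi : s / l *: s}.
Proof. by move=> s; rewrite (_ : l *: psi s = scale l (psi s))// /scale psiK. Qed.

End CFA_lmodType.

Section CFA_ops.
Context {R : realType} {A : fuzzy_number R} {hA : asymmetric A}.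
Local Notation m := ((midpoint A)%:C).

Definition cross (x y : CFA hA) : CFA hA :=
  let: (u, v) := psi_inv x in let: (z, w) := psi_inv y in
  psi (u * z - m ^+ 2 * (v * w), u * w + z * v + 2 * m * (v * w)).

Definition fuzzy_pnorm (p : R) (x : CFA hA) : R :=
  let: (u, v) := psi_inv x in
  (normc (u + m * v) `^ p + normc v `^ p) `^ p^-1.

End CFA_ops.

(* The sigma-algebra of R^n is the one generated by the coordinates, i.e. the
   Borel one. *)
Section rV_measurable.
Context {R : realType} (n : nat).
Let coord (i : 'I_n) (x : 'rV[R]_n) : measurableTypeR R := x ord0 i.

Let rV_set0 : g_sigma_preimage coord set0.
Proof. exact: sigma_algebra0. Qed.
Let rV_setC A : g_sigma_preimage coord A -> g_sigma_preimage coord (~` A).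
Proof. exact: sigma_algebraC. Qed.
Let rV_bigcup (F : (set 'rV[R]_n)^nat) : (forall i, g_sigma_preimage coord (F i)) ->
  g_sigma_preimage coord (\bigcup_i F i).
Proof. exact: sigma_algebra_bigcup. Qed.

HB.instance Definition _ := @isMeasurable.Build default_measure_display
  'rV[R]_n (g_sigma_preimage coord) rV_set0 rV_setC rV_bigcup.

Lemma measurable_coord (i : 'I_n) :
  measurable_fun setT (fun x : 'rV[R]_n => x ord0 i : measurableTypeR R).
Proof.
move=> _ Y mY; rewrite setTI; apply: sub_sigma_algebra => /=.
rewrite -bigcup_seq/=; exists i => /=; first by rewrite mem_index_enum.
by exists Y => //; rewrite setTI.
Qed.

Lemma measurable_fun_rVP d (T : measurableType d) (f : T -> 'rV[R]_n) :
  (forall i, measurable_fun setT (fun t => f t ord0 i : measurableTypeR R)) ->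
  measurable_fun setT f.
Proof.
move=> mf; have : g_sigma_preimage (fun i t => f t ord0 i : measurableTypeR R) `<=` measurable.
  apply: smallest_sub; first exact: sigma_algebra_measurable.
  move=> B; rewrite -bigcup_seq => -[i _ [C mC <-]]; exact: mf.
rewrite (g_sigma_preimage_comp coord f) => h _ Y mY.
by apply: h; exists Y => //; rewrite setTI.
Qed.

End rV_measurable.

Section lebesgue_rV.
Context {R : realType}.

Definition rV_cons n (xy : measurableTypeR R * 'rV[R]_n) : 'rV[R]_n.+1 :=
  row_mx (xy.1%:M : 'rV[R]_1) xy.2.

Definition rV_uncons n (z : 'rV[R]_n.+1) : measurableTypeR R * 'rV[R]_n :=
  (z ord0 ord0, \row_i z ord0 (lift ord0 i)).

Lemma rV_consK n : cancel (@rV_cons n) (@rV_uncons n).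
Proof.
move=> [x y]; rewrite /rV_cons /rV_uncons/=; congr pair.
  have := @row_mxEl _ 1 1 n x%:M y ord0 ord0; rewrite [RHS]mxE eqxx mulr1n => E.
  rewrite -[RHS]E.
  by congr (fun_of_matrix _ _ _); exact: val_inj.
apply/rowP => i; rewrite mxE; rewrite -[RHS](@row_mxEr _ 1 1 n x%:M y ord0 i).
by congr (fun_of_matrix _ _ _); exact: val_inj.
Qed.

Lemma rV_consE n (xy : measurableTypeR R * 'rV[R]_n) (i : 'I_n.+1) :
  rV_cons xy ord0 i = if unlift ord0 i is Some j then xy.2 ord0 j else xy.1.
Proof.
have [j ->|->] := unliftP ord0 i; last first.
  exact: (congr1 (fun z : measurableTypeR R * _ => z.1) (rV_consK xy)).
have /rowP/(_ j) := congr1 snd (rV_consK xy).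
by rewrite /= mxE.
Qed.

Lemma measurable_rV_cons n : measurable_fun setT (@rV_cons n).
Proof.
apply: measurable_fun_rVP => i.
case: (split_ordP (i : 'I_(1 + n))) => j ->.
  apply: (eq_measurable_fun fst); last exact: measurable_fst.
  by move=> [x y] _; rewrite /rV_cons /= (@row_mxEl _ 1 1 n) (ord1 j) [RHS]mxE.
apply: (eq_measurable_fun ((fun y : 'rV[R]_n => y ord0 j) \o snd)).
  by move=> [x y] _; rewrite /rV_cons /= (@row_mxEr _ 1 1 n).
by apply: measurableT_comp; [exact: measurable_coord|exact: measurable_snd].
Qed.

Lemma measurable_rV_uncons n : measurable_fun setT (@rV_uncons n).
Proof.
apply/measurable_fun_pairP; split => /=; first exact: measurable_coord.
apply: measurable_fun_rVP => i.
apply: (eq_measurable_fun (fun x : 'rV[R]_n.+1 => x ord0 (lift ord0 i))).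
  by move=> x _; rewrite /= mxE.
exact: measurable_coord.
Qed.

Lemma prod_sigma_finite n (mu : {sigma_finite_measure set 'rV[R]_n -> \bar R}) :
  sigma_finite setT (@lebesgue_measure R \x mu)%E.
Proof.
have /sigma_finiteP[F [TF ndF Foo]] := sigma_finiteT (@lebesgue_measure R).
have /sigma_finiteP[G [TG ndG Goo]] := sigma_finiteT mu.
exists (fun n => F n `*` G n).
  rewrite -setXTT TF TG predeqE => -[x y]; split.
    move=> [/= [i _ Fix] [k _ Gky]]; exists (maxn i k) => //; split.
    - by move: x Fix; exact/subsetPset/ndF/leq_maxl.
    - by move: y Gky; exact/subsetPset/ndG/leq_maxr.
  by move=> [i _ []/= ? ?]; split; exists i.
move=> k; have [? ?] := Foo k; have [? ?] := Goo k.
split; first exact: measurableX.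
by rewrite product_measure1E// lte_mul_pinfty// ge0_fin_numE.
Qed.

Section step.
Context n (mu : {sigma_finite_measure set 'rV[R]_n -> \bar R}).
Local Open Scope ereal_scope.

Definition lebesgue_step : set 'rV[R]_n.+1 -> \bar R :=
  pushforward (@lebesgue_measure R \x mu) (@rV_cons n).

Let step0 : lebesgue_step set0 = 0.
Proof. by rewrite /lebesgue_step /pushforward preimage_set0 measure0. Qed.
Let step_ge0 X : 0 <= lebesgue_step X.
Proof. by rewrite /lebesgue_step /pushforward measure_ge0. Qed.
Let step_sigma_additive : semi_sigma_additive lebesgue_step.
Proof.
move=> F mF tF mUF; rewrite /lebesgue_step /pushforward preimage_bigcup.
apply: measure_semi_sigma_additive.
- by move=> k; rewrite -[X in measurable X]setTI; exact: measurable_rV_cons.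
- apply/trivIsetP => /= i j _ _ ij; rewrite -preimage_setI.
  by move/trivIsetP : tF => /(_ _ _ _ _ ij) ->//; rewrite preimage_set0.
- by rewrite -preimage_bigcup -[X in measurable X]setTI; exact: measurable_rV_cons.
Qed.

HB.instance Definition _ :=
  isMeasure.Build _ _ _ lebesgue_step step0 step_ge0 step_sigma_additive.

Let step_sigma_finite : sigma_finite setT lebesgue_step.
Proof.
have [F TF Foo] := prod_sigma_finite mu.
exists (fun i => @rV_uncons n @^-1` F i).
  by rewrite -preimage_bigcup -TF preimage_setT.
move=> i; have [mF Fi] := Foo i; split.
  by rewrite -[X in measurable X]setTI; exact: measurable_rV_uncons.
rewrite /lebesgue_step /pushforward -comp_preimage (_ : _ \o _ = id)//.
by apply/funext => x /=; rewrite rV_consK.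
Qed.

HB.instance Definition _ :=
  Measure_isSigmaFinite.Build _ _ _ lebesgue_step step_sigma_finite.

End step.

Fixpoint lebesgue_rV n : {sigma_finite_measure set 'rV[R]_n -> \bar R} :=
  if n is n'.+1 then lebesgue_step (lebesgue_rV n') else dirac (0 : 'rV[R]_0).

End lebesgue_rV.

Lemma lebesgue_rV_box (R : realType) n (B : 'I_n -> set (measurableTypeR R)) :
  (forall i, measurable (B i)) ->
  (lebesgue_rV n [set x : 'rV[R]_n | forall i, B i (x ord0 i)] =
   \big[mule/1%:E]_(i < n) lebesgue_measure (B i))%E.
Proof.
elim: n B => [|n IH] B mB.
  by rewrite big_ord0 /= diracE mem_set//= => -[].
rewrite big_ord_recl -IH; last by move=> i; exact: mB.
have mE : measurable [set x : 'rV[R]_n | forall i, B (lift ord0 i) (x ord0 i)].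
  rewrite (_ : mkset _ = \bigcap_(i in [set: 'I_n])
    ((fun x : 'rV[R]_n => x ord0 i : measurableTypeR R) @^-1` B (lift ord0 i))).
    apply: fin_bigcap_measurable => [|i _]; first exact: finite_finset.
    by rewrite -[X in measurable X]setTI; exact: measurable_coord.
  by apply/seteqP; split => x /= h i; [move=> _|]; exact: h.
rewrite -product_measure1E// /= /lebesgue_step /pushforward.
congr (product_measure1 _ _ _); apply/seteqP; split => -[x y] /=.
  move=> h; split; first by have := h ord0; rewrite rV_consE unlift_none.
  by move=> i; have := h (lift ord0 i); rewrite rV_consE liftK.
by move=> [Bx By] i; rewrite rV_consE; case: unliftP => [j ->|->].
Qed.

(* Functions on Om are represented by total functions of which only the values
   on Om matter: classes are taken modulo equality almost everywhere on Om. *)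
Section ae_quotient.
Context {R : realType} {n : nat} (Om : set 'rV[R]_n) (V : lmodType R[i]).
Implicit Types (F G H : 'rV[R]_n -> V) (l : R[i]).

Definition ae_rel F G : bool := `[< F = G %[ae (lebesgue_rV n) in Om] >].

Let ae_rel_refl : reflexive ae_rel.
Proof. by move=> F; apply/asboolP; exact: ae_eq_refl. Qed.
Let ae_rel_sym : symmetric ae_rel.
Proof. by move=> F G; apply/asboolP/asboolP; exact: ae_eq_sym. Qed.
Let ae_rel_trans : transitive ae_rel.
Proof. by move=> G F H /asboolP h1 /asboolP h2; apply/asboolP; exact: ae_eq_trans h1 h2. Qed.

Canonical ae_equiv := EquivRel ae_rel ae_rel_refl ae_rel_sym ae_rel_trans.

Local Open Scope quotient_scope.

Definition ae_class : Type := {eq_quot ae_rel}.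
HB.instance Definition _ := Choice.on ae_class.
HB.instance Definition _ := EqQuotient.on ae_class.

Definition to_class F : ae_class := \pi_ae_class F.

Lemma to_classP F G : to_class F = to_class G <-> F = G %[ae (lebesgue_rV n) in Om].
Proof. by split => [/eqquotP/asboolP//|h]; apply/eqquotP/asboolP. Qed.

Lemma to_class_repr q : to_class (repr q) = q.
Proof. exact: reprK. Qed.

Let add (q r : ae_class) : ae_class := to_class (repr q + repr r).
Let opp (q : ae_class) : ae_class := to_class (- repr q).
Let scale l (q : ae_class) : ae_class := to_class (l *: repr q).

Let addE F G : add (to_class F) (to_class G) = to_class (F + G).
Proof.
apply/to_classP; have /to_classP h1 := to_class_repr (to_class F).
have /to_classP h2 := to_class_repr (to_class G).
by apply: filterS2 h1 h2 => x e1 e2 Ox; rewrite /= !fctE e1// e2.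
Qed.

Let oppE F : opp (to_class F) = to_class (- F).
Proof.
apply/to_classP; have /to_classP := to_class_repr (to_class F).
by apply: filterS => x e1 Ox; rewrite /= !fctE e1.
Qed.

Let scaleE l F : scale l (to_class F) = to_class (l *: F).
Proof.
apply/to_classP; have /to_classP := to_class_repr (to_class F).
by apply: filterS => x e1 Ox; rewrite /= !fctE e1.
Qed.

Let addA : associative add.
Proof.
by move=> q r s; rewrite -(to_class_repr q) -(to_class_repr r) -(to_class_repr s) !addE addrA.
Qed.
Let addC : commutative add.
Proof. by move=> q r; rewrite /add addrC. Qed.
Let add0 : left_id (to_class 0) add.
Proof. by move=> q; rewrite -(to_class_repr q) addE add0r. Qed.
Let addN : left_inverse (to_class 0) opp add.
Proof. by move=> q; rewrite -(to_class_repr q) oppE addE addNr. Qed.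

HB.instance Definition _ := GRing.isZmodule.Build ae_class addA addC add0 addN.

Let scaleA l m q : scale l (scale m q) = scale (l * m) q.
Proof. by rewrite -(to_class_repr q) !scaleE scalerA. Qed.
Let scale1 : left_id 1 scale.
Proof. by move=> q; rewrite -(to_class_repr q) scaleE scale1r. Qed.
Let scaleDr : right_distributive scale +%R.
Proof.
move=> l q r; rewrite -(to_class_repr q) -(to_class_repr r).
by rewrite [_ + _ in LHS]addE !scaleE [RHS]addE scalerDr.
Qed.
Let scaleDl q : {morph scale^~ q : l m / l + m}.
Proof.
by move=> l m; rewrite -(to_class_repr q) !scaleE [RHS]addE scalerDl.
Qed.

HB.instance Definition _ :=
  GRing.Zmodule_isLmodule.Build R[i] ae_class scaleA scale1 scaleDr scaleDl.

Lemma to_class_is_linear : linear to_class.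
Proof. by move=> l F G; rewrite -[RHS]/(add (scale _ _) _) scaleE addE. Qed.

End ae_quotient.

Arguments to_class {R n} Om {V} F.

Section calculus.
Context {R : realType} {n : nat}.
Local Notation leb := (lebesgue_rV n).
Implicit Types (f : 'rV[R]_n -> R) (u : 'rV[R]_n -> R[i]) (al : 'I_n -> nat).

Definition partial (i : 'I_n) f : 'rV[R]_n -> R :=
  fun x => 'D_(delta_mx ord0 i) f x.

(* C^oo: all iterated partial derivatives exist and are continuous. *)
Definition smooth f := forall s : seq 'I_n,
  let g := foldr partial f s in
  continuous g /\ forall i x, derivable g x (delta_mx ord0 i).

(* A multi-index with all entries at most k, as needed to sum over the finitely
   many multi-indices of length at most k. *)
Definition mindex k (al : {ffun 'I_n -> 'I_k.+1}) : 'I_n -> nat := fun i => al i.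

Definition mdeg al : nat := (\sum_i al i)%N.

Definition multi_partial al f : 'rV[R]_n -> R :=
  foldr (fun i g => iter (al i) (partial i) g) f (enum 'I_n).

Definition re u : 'rV[R]_n -> R := fun x => complex.Re (u x).
Definition im u : 'rV[R]_n -> R := fun x => complex.Im (u x).

Definition csmooth u := smooth (re u) /\ smooth (im u).

Definition cpartial al u : 'rV[R]_n -> R[i] :=
  fun x => multi_partial al (re u) x +i* multi_partial al (im u) x.

Definition cmeasurable (D : set 'rV[R]_n) u :=
  measurable_fun D (re u) /\ measurable_fun D (im u).

Definition cintegrable (D : set 'rV[R]_n) u :=
  leb.-integrable D (EFin \o re u) /\ leb.-integrable D (EFin \o im u).

Definition cintegral (D : set 'rV[R]_n) u : R[i] :=
  (\int[leb]_(x in D) re u x) +i* (\int[leb]_(x in D) im u x).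

(* A test function on Om is extended by 0 to R^n. *)
Definition compact_support (V : zmodType) (Om : set 'rV[R]_n) (F : 'rV[R]_n -> V) :=
  let K := closure [set x | F x != 0] in compact K /\ K `<=` Om.

End calculus.

Section sobolev.
Context {R : realType} {n : nat} (Om : set 'rV[R]_n).
Local Notation leb := (lebesgue_rV n).
Implicit Types (u v g : 'rV[R]_n -> R[i]) (al : 'I_n -> nat) (k : nat) (p : R).

Definition test_function u := csmooth u /\ compact_support Om u.

Definition L1loc u := forall K, compact K -> K `<=` Om -> cintegrable K u.

Definition is_weak_derivative al u g := [/\ L1loc u, L1loc g &
  forall phi, test_function phi ->
    cintegral Om (fun x => u x * cpartial al phi x) =
    (-1) ^+ mdeg al * cintegral Om (fun x => g x * phi x)].

Definition Lp_norm p u : \bar R :=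
  ((\int[leb]_(x in Om) (normc (u x) `^ p)%:E) `^ p^-1)%E.

Definition Lp p u := cmeasurable Om u /\ (Lp_norm p u < +oo)%E.

Definition sobolev k p u := Lp p u /\
  forall al, (mdeg al <= k)%N -> exists2 g, is_weak_derivative al u g & Lp p g.

(* Weak derivatives are unique up to equality almost everywhere on Om; one is
   chosen when there is one. *)
Definition weak_derivative al u : 'rV[R]_n -> R[i] :=
  xget 0 [set g | is_weak_derivative al u g].

(* ||(u, v)||_{m-p,k} *)
Definition mp_norm k p u v : R :=
  \sum_(al : {ffun 'I_n -> 'I_k.+1} | (mdeg (mindex al) <= k)%N)
    Num.max (fine (Lp_norm p (weak_derivative (mindex al) u)))
            (fine (Lp_norm p (weak_derivative (mindex al) v))).

End sobolev.

Section fuzzy_sobolev.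
Context {R : realType} {A : fuzzy_number R} (hA : asymmetric A).
Context {n : nat} (Om : set 'rV[R]_n).
Implicit Types (F G : 'rV[R]_n -> CFA hA) (al : 'I_n -> nat) (k : nat) (p : R).

Definition coordu F : 'rV[R]_n -> R[i] := fun x => (psi_inv (F x)).1.
Definition coordv F : 'rV[R]_n -> R[i] := fun x => (psi_inv (F x)).2.

(* Differentiability, measurability and integrability of functions with values
   in the two-dimensional space CFA are those of the two coordinates. *)
Definition fuzzy_partial al F : 'rV[R]_n -> CFA hA :=
  fun x => psi (cpartial al (coordu F) x, cpartial al (coordv F) x).

Definition fuzzy_integral (D : set 'rV[R]_n) F : CFA hA :=
  psi (cintegral D (coordu F), cintegral D (coordv F)).

Definition fuzzy_test_function F :=
  [/\ csmooth (coordu F), csmooth (coordv F) & compact_support Om F].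

Definition fuzzy_L1loc F := forall K, compact K -> K `<=` Om ->
  cintegrable K (coordu F) /\ cintegrable K (coordv F).

Definition is_fuzzy_weak_derivative al F G := [/\ fuzzy_L1loc F, fuzzy_L1loc G &
  forall Phi, fuzzy_test_function Phi ->
    fuzzy_integral Om (fun x => cross (F x) (fuzzy_partial al Phi x)) =
    (-1) ^+ mdeg al *: fuzzy_integral Om (fun x => cross (G x) (Phi x))].

Definition fuzzy_Lp_norm p F : \bar R :=
  ((\int[lebesgue_rV n]_(x in Om) (fuzzy_pnorm p (F x) `^ p)%:E) `^ p^-1)%E.

Definition fuzzy_Lp p F := [/\ cmeasurable Om (coordu F), cmeasurable Om (coordv F) &
  (fuzzy_Lp_norm p F < +oo)%E].

Definition fuzzy_sobolev k p F := fuzzy_Lp p F /\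
  forall al, (mdeg al <= k)%N ->
    exists2 G, is_fuzzy_weak_derivative al F G & fuzzy_Lp p G.

Definition fuzzy_weak_derivative al F : 'rV[R]_n -> CFA hA :=
  xget 0 [set G | is_fuzzy_weak_derivative al F G].

Definition fuzzy_sobolev_norm k p F : R :=
  \sum_(al : {ffun 'I_n -> 'I_k.+1} | (mdeg (mindex al) <= k)%N)
    fine (fuzzy_Lp_norm p (fuzzy_weak_derivative (mindex al) F)).

End fuzzy_sobolev.

Section spaces.
Context {R : realType} {n : nat} (Om : set 'rV[R]_n).
Implicit Types (k : nat) (p : R).

(* The norm of a class is the norm of a representative in the function-level
   Sobolev set W. *)
Definition representative (V : lmodType R[i]) (W : set ('rV[R]_n -> V))
    (q : ae_class Om V) : 'rV[R]_n -> V :=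
  xget 0 [set F | W F /\ to_class Om F = q].

Definition Wkp k p : set (ae_class Om R[i]) := to_class Om @` sobolev Om k p.

Definition Wkp_pair_norm k p (q : ae_class Om R[i] * ae_class Om R[i]) : R :=
  mp_norm Om k p (representative (sobolev Om k p) q.1)
                 (representative (sobolev Om k p) q.2).

Context {A : fuzzy_number R} (hA : asymmetric A).

Definition fuzzy_Wkp k p : set (ae_class Om (CFA hA)) :=
  to_class Om @` fuzzy_sobolev Om k p.

Definition fuzzy_Wkp_norm k p (q : ae_class Om (CFA hA)) : R :=
  fuzzy_sobolev_norm Om k p (representative (fuzzy_sobolev Om k p) q).

Definition Psi (q : ae_class Om (CFA hA)) : ae_class Om R[i] * ae_class Om R[i] :=
  (to_class Om (coordu (repr q)), to_class Om (coordv (repr q))).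

Lemma PsiE (F : 'rV[R]_n -> CFA hA) :
  Psi (to_class Om F) = (to_class Om (coordu F), to_class Om (coordv F)).
Proof.
have /to_classP h := to_class_repr (to_class Om F).
by congr pair; apply/to_classP; apply: filterS h => x e Ox;
  rewrite /coordu /coordv e.
Qed.

End spaces.
Arguments Wkp {R n} Om k p.
Arguments Wkp_pair_norm {R n} Om k p q.
Arguments fuzzy_Wkp {R n} Om {A} hA k p.
Arguments fuzzy_Wkp_norm {R n} Om {A} hA k p q.
Arguments Psi {R n} Om {A} hA q.

Section normed_isomorphism.
Context {R : realType}.

Definition linear_on (V1 V2 : lmodType R[i]) (W : set V1) (f : V1 -> V2) :=
  forall (l : R[i]) x y, W x -> W y -> f (l *: x + y) = l *: f x + f y.

Definition norm_continuous (V1 V2 : zmodType) (W : set V1)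
    (N1 : V1 -> R) (N2 : V2 -> R) (f : V1 -> V2) :=
  forall x, W x -> forall e, 0 < e -> exists2 d, 0 < d &
    forall y, W y -> N1 (y - x) < d -> N2 (f y - f x) < e.

Context {V1 V2 : lmodType R[i]} (S : set V1) (T : set V2).
Context (N1 : V1 -> R) (N2 : V2 -> R).
Implicit Types f : V1 -> V2.

Definition homeomorphism_on f :=
  [/\ set_bij S T f, norm_continuous S N1 N2 f &
      exists2 g : V2 -> V1, {in S, cancel f g} & norm_continuous T N2 N1 g].

Definition linear_homeomorphism f := linear_on S f /\ homeomorphism_on f.

Definition isomorphic := exists f, linear_on S f /\ set_bij S T f.

Definition homeomorphic := exists f, homeomorphism_on f.

End normed_isomorphism.

(* Main.v *)
Require Import Defs.
From mathcomp Require Import all_boot all_order all_algebra.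
From mathcomp Require Import all_classical all_reals all_analysis.
From mathcomp Require Import measurable_realfun complex lra ring.
Import Order.TTheory GRing.Theory Num.Theory.
Import numFieldNormedType.Exports.
Local Open Scope classical_set_scope.
Local Open Scope ring_scope.

(** Write F = u + vA. The theorem rests on a description of weak derivatives in the
    coordinates u and v and on the almost everywhere uniqueness of weak derivatives.

    The A-cross product is bilinear in the coordinates. Testing F against phi + 0A
    gives the weak derivative identities for u and for v against phi, and every
    other identity for F is a linear combination of such identities. Hence G is a
    weak derivative of F exactly when the coordinates of G are weak derivatives of
    the coordinates of F ([fuzzy_weak_derivativeP]). Pointwise, the norm
    (|u + mv|^p + |v|^p)^(1/p) and |u| + |v| bound each other up to a constant that
    depends only on the midpoint m, so F lies in L^p exactly when u and v do
    ([fuzzy_LpP]). It follows that Psi, which is linear and injective on all classes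
    of functions, maps the fuzzy Sobolev space onto the product of the complex ones
    ([fuzzy_WkpP]).

    The norms of a class are computed from a chosen representative and from chosen
    weak derivatives, independently on the two sides. They can be compared because
    weak derivatives of almost everywhere equal functions are almost everywhere
    equal ([weak_derivative_unique]); then the pointwise comparison, applied to each
    D^alpha F, bounds each norm by a constant multiple of the other
    ([Psi_norm_bounds]), and by linearity Psi and its inverse are Lipschitz.

    Uniqueness is the fundamental lemma of the calculus of variations
    ([du_Bois_Reymond]): a locally integrable g that is orthogonal to all test
    functions vanishes almost everywhere. The products over the coordinates of
    exp(-c / (x_i - a_i)) exp(-c / (b_i - x_i)) are smooth, vanish off the open box
    with corners a and b, and converge to the indicator function of that box when c
    tends to 0. By dominated convergence the integral of g over every box with
    closure in Omega is 0; by the pi-lambda theorem the same holds for the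
    measurable subsets of such a box, so g vanishes almost everywhere on it, and
    countably many such boxes cover Omega. *)

Set Implicit Arguments.
Unset Strict Implicit.
Unset Printing Implicit Defensive.

(** * Boxes, open sets and measurability in R^n *)

Section boxes.
Context {R : realType} {n : nat}.
Implicit Types (a b : 'I_n -> R) (x : 'rV[R]_n) (Om : set 'rV[R]_n).

Definition obox a b : set 'rV[R]_n := [set x | forall i, a i < x ord0 i < b i].
Definition cbox a b : set 'rV[R]_n := [set x | forall i, a i <= x ord0 i <= b i].

Lemma obox_cbox a b : obox a b `<=` cbox a b.
Proof. by move=> x h i; have /andP[/ltW -> /ltW ->] := h i. Qed.

Lemma cbox_compact a b : compact (cbox a b).
Proof.
have := @rV_compact R n (fun i => `[a i, b i]%classic) (fun i => @segment_compact _ _ _).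
congr compact; apply/seteqP; split => x /= h i; have := h i; by rewrite /= in_itv.
Qed.

Lemma coord_preimage_measurable (i : 'I_n) (B : set (measurableTypeR R)) :
  measurable B -> measurable [set x : 'rV[R]_n | B (x ord0 i)].
Proof. by move=> mB; rewrite -[X in measurable X]setTI; exact: measurable_coord. Qed.

Lemma box_measurable (B : 'I_n -> set (measurableTypeR R)) :
  (forall i, measurable (B i)) ->
  measurable [set x : 'rV[R]_n | forall i, B i (x ord0 i)].
Proof.
move=> mB; rewrite (_ : mkset _ =
    \bigcap_(i in [set: 'I_n]) [set x : 'rV[R]_n | B i (x ord0 i)]).
  apply: fin_bigcap_measurable => [|i _]; first exact: finite_finset.
  exact: coord_preimage_measurable.
by apply/seteqP; split => x /= h i; [move=> _|]; exact: h.
Qed.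

Lemma obox_measurable a b : measurable (obox a b).
Proof.
have := @box_measurable (fun i => `]a i, b i[%classic) (fun i => measurable_itv _).
congr measurable; apply/seteqP; split => x /= h i; have := h i; by rewrite /= in_itv.
Qed.

(** Boxes with rational vertices are countably many, and small ones are a basis
    of the topology. The closed boxes stay inside [Om], so that this is at the
    same time an exhaustion of [Om] by compact sets. Countability comes from
    decoding natural numbers into families of pairs of rationals. *)
Lemma open_bigcup_boxes Om : open Om ->
  exists (J : set nat) (a b : nat -> 'I_n -> R),
    (forall j, J j -> cbox (a j) (b j) `<=` Om) /\
    Om = \bigcup_(j in J) obox (a j) (b j).
Proof.
move=> oOm; pose q j : {ffun 'I_n -> rat * rat} := odflt [ffun=> (0, 0)] (unpickle j).
pose a j (i : 'I_n) : R := ratr (q j i).1; pose b j (i : 'I_n) : R := ratr (q j i).2.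
exists [set j | cbox (a j) (b j) `<=` Om], a, b; split => //.
apply/seteqP; split => [x Ox|x [j /= sub /obox_cbox]]; last exact: sub.
have /nbhs_ballP[e /= e0 eOm] : nbhs x Om by exact: open_nbhs_nbhs.
have /choice[f fP] : forall i : 'I_n, exists p : rat * rat,
   [/\ x ord0 i - e / 2 < ratr p.1, ratr p.1 < x ord0 i,
       x ord0 i < ratr p.2 & ratr p.2 < x ord0 i + e / 2].
  move=> i; have e2 : 0 < e / 2 by rewrite divr_gt0.
  have [p] : exists q, ratr q \in `](x ord0 i - e / 2), (x ord0 i)[.
    by apply: rat_in_itvoo; lra.
  have [r] : exists q, ratr q \in `](x ord0 i), (x ord0 i + e / 2)[.
    by apply: rat_in_itvoo; lra.
  by rewrite !in_itv/= => /andP[? ?] /andP[? ?]; exists (p, r).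
have qE : q (pickle [ffun i => f i]) = [ffun i => f i] by rewrite /q pickleK.
exists (pickle [ffun i => f i]) => /=; last first.
  by move=> i; rewrite /a /b qE ffunE; have [? -> ->] := fP i.
move=> y; rewrite /cbox /a /b /= qE => yb; apply: eOm; split => // k i.
rewrite (ord1 k) /ball /=; have := yb i; rewrite ffunE; have [h1 h2 h3 h4] := fP i.
by move=> /andP[h5 h6]; rewrite ltr_norml; apply/andP; split; lra.
Qed.

Lemma open_measurable_rV Om : open Om -> measurable Om.
Proof.
move=> /open_bigcup_boxes[J [a [b [_ ->]]]].
by apply: bigcup_measurable => j _; exact: obox_measurable.
Qed.

Lemma closed_measurable_rV (K : set 'rV[R]_n) : closed K -> measurable K.
Proof. by move=> /closed_openC/open_measurable_rV/measurableC; rewrite setCK. Qed.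

Lemma compact_measurable_rV (K : set 'rV[R]_n) : compact K -> measurable K.
Proof.
move=> cK; apply: closed_measurable_rV; exact: compact_closed.
Qed.

(** The sigma-algebra at hand is generated by the coordinates; being Borel is a
    consequence of [open_bigcup_boxes]. *)
Lemma continuous_measurable_rV (f : 'rV[R]_n -> R) D :
  continuous f -> measurable_fun D f.
Proof.
move=> cf; apply: measurable_funTS.
apply: (measurability _ (RGenOInfty.measurableE R)) => //.
move=> _ [_ [a ->] <-]; rewrite setTI; apply: open_measurable_rV.
by apply: open_comp => //; exact: interval_open.
Qed.

End boxes.
Arguments cbox_compact {R n} a b.

(** * Smooth bump functions *)

Section flat.
Context {R : realType}.
Implicit Types (P : {poly R}) (c s t : R).

(** Exponential decay beats polynomial growth; by induction on [P], spending half
    of the decay rate on each factor [s]. *)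
Lemma poly_expR_bounded c P : 0 < c ->
  exists2 M, 0 <= M & forall s, 0 <= s -> `|P.[s]| * expR (- (c * s)) <= M.
Proof.
elim/poly_ind: P c => [|P a IH] c c0.
  by exists 0 => // s _; rewrite horner0 normr0 mul0r.
have c20 : 0 < c / 2 by rewrite divr_gt0.
have [M M0 PM] := IH _ c20.
exists (M * (c / 2)^-1 + `|a|).
  by rewrite addr_ge0// mulr_ge0// invr_ge0 ltW.
move=> s s0; rewrite hornerMXaddC.
apply: (@le_trans _ _ ((`|P.[s]| * s + `|a|) * expR (- (c * s)))).
  rewrite ler_wpM2r ?expR_ge0//; apply: le_trans (ler_normD _ _) _.
  by rewrite normrM (ger0_norm s0).
rewrite mulrDl lerD//; last first.
  by rewrite ler_piMr// -expR0 ler_expR oppr_le0 mulr_ge0// ltW.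
have -> : - (c * s) = - (c / 2 * s) + - (c / 2 * s) by lra.
rewrite expRD mulrACA ler_pM// ?mulr_ge0 ?expR_ge0//; first exact: PM.
rewrite expRN -(ler_pM2l c20) divff ?gt_eqF// mulrA ler_pdivrMr ?expR_gt0// mul1r.
by apply: le_trans (expR_ge1Dx _); rewrite lerDr.
Qed.

(** The functions P(1/t) exp(-c/t), extended by 0 to t <= 0. The polynomial makes
    the family closed under differentiation. *)
Definition flat c P t : R := if 0 < t then P.[t^-1] * expR (- (c * t^-1)) else 0.

(** This is differentiability at 0, with derivative 0: the factor 1/t^2 is absorbed
    by the polynomial in 1/t, which is why the bound holds for all [P] at once. *)
Lemma flat_quadratic c P : 0 < c -> exists2 M, 0 <= M & forall t, `|flat c P t| <= M * t ^+ 2.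
Proof.
move=> c0; have [M M0 PM] := poly_expR_bounded ('X^2 * P) c0.
exists M => // t; rewrite /flat; case: ifPn => t0; last first.
  by rewrite normr0 mulr_ge0// sqr_ge0.
have := PM t^-1; rewrite invr_ge0 (ltW t0) => /(_ isT).
rewrite hornerM hornerXn normrM (ger0_norm (sqr_ge0 _)) -mulrA exprVn.
rewrite [_^-1 * _]mulrC ler_pdivrMr ?exprn_gt0//.
by rewrite normrM (ger0_norm (expR_ge0 _)).
Qed.

Lemma is_derive_flat c P t : 0 < c ->
  is_derive t 1 (flat c P) (flat c ('X^2 * (c *: P - P^`())) t).
Proof.
move=> c0; have [t0|t0|<-] := ltgtP 0 t.
- rewrite {2}/flat t0.
  have tn0 : t != 0 by rewrite gt_eqF.
  apply: (@near_eq_is_derive _ _ _ ((horner P \o (fun y : R => y^-1)) *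
    (expR \o (fun y : R => - (c * y^-1))))).
    near=> s; rewrite /flat; have -> : 0 < s by near: s; exact: lt_nbhsr.
    by [].
  have dV : is_derive t 1 (fun y : R => y^-1) (- t ^- 2 *: 1).
    exact: (@is_deriveV _ id).
  have dP : is_derive t 1 (horner P \o (fun y : R => y^-1)) (P^`().[t^-1] * (- t ^- 2 *: 1)).
    exact: is_derive1_comp.
  have dE : is_derive t 1 (expR \o (fun y : R => - (c * y^-1)))
      (expR (- (c * t^-1)) * (- (c *: (- t ^- 2 *: 1)))).
    have dN : is_derive t 1 (- (c *: (fun y : R => y^-1))) (- (c *: (- t ^- 2 *: 1))).
      exact: is_deriveN.
    exact: is_derive1_comp.
  have dM := is_deriveM dP dE.
  apply: (is_derive_eq dM).
  rewrite /= hornerM hornerXn hornerD hornerN hornerZ exprVn /GRing.scale /=.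
  ring.
- rewrite {2}/flat ltNge (ltW t0) /=.
  apply: (@near_eq_is_derive _ _ _ (cst 0)).
  near=> s; rewrite /flat ltNge; have -> // : s <= 0.
  by apply: ltW; near: s; exact: lt_nbhsl.
- rewrite {2}/flat ltxx.
  have [M M0 PM] := flat_quadratic P c0.
  suff h : (fun h => h^-1 *: ((flat c P \o shift 0) (h *: 1) - flat c P 0)) @ 0^' --> (0 : R).
    by apply: DeriveDef; [apply/cvg_ex; exists 0|exact: cvg_lim h].
  have M1 : 0 < M + 1 by rewrite ltr_wpDl.
  apply/cvgr0Pnorm_le => e e0; near=> h.
  have hn0 : h != 0 by near: h; exact: nbhs_dnbhs_neq.
  rewrite /= /shift /= addr0 {2}/flat ltxx subr0 /GRing.scale /= mulr1 normrM normfV.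
  rewrite ler_pdivrMl ?normr_gt0//; apply: le_trans (PM _) _.
  rewrite -(real_normK (num_real h)) mulrC expr2 -mulrA ler_wpM2l// mulrC.
  apply: (@le_trans _ _ ((M + 1) * `|h|)); first by rewrite ler_wpM2r// lerDl.
  rewrite mulrC -ler_pdivlMr//; near: h; apply: dnbhs0_le.
  exact: divr_gt0.
Unshelve. all: by end_near. Qed.

Lemma flat_eq0 c P t : t <= 0 -> flat c P t = 0.
Proof. by rewrite /flat leNgt => /negbTE ->. Qed.

Lemma flat01 c t : 0 <= c -> 0 <= flat c 1 t <= 1.
Proof.
move=> c0; rewrite /flat; case: ifPn => t0; last by rewrite lexx ler01.
rewrite hornerC mul1r expR_ge0 -expR0 ler_expR oppr_le0 mulr_ge0//.
by rewrite invr_ge0 ltW.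
Qed.

Lemma cvg_flat t : 0 < t -> flat j.+1%:R^-1 1 t @[j --> \oo] --> (1 : R).
Proof.
move=> t0; rewrite (_ : (fun j => _) = expR \o (fun j => - (j.+1%:R^-1 * t^-1))); last first.
  by apply/funext => j; rewrite /flat t0 hornerC mul1r.
rewrite -[X in _ --> X](@expR0 R); apply: continuous_cvg; first exact: continuous_expR.
rewrite (_ : 0 = - (0 * t^-1)); last by rewrite mul0r oppr0.
by apply: cvgN; apply: cvgM; [exact: cvg_harmonic|exact: cvg_cst].
Qed.

End flat.

Section bumps.
Context {R : realType} {n : nat}.
Implicit Types (f g : 'rV[R]_n -> R) (x : 'rV[R]_n) (i j : 'I_n).

Lemma is_derive_line f x v (df : R) :
  is_derive (0 : R) (1 : R) (fun h : R => f (h *: v + x)) df -> is_derive x v f df.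
Proof.
move=> [ex val]; apply: DeriveDef; first exact/derivable1P.
rewrite -val /derive; congr (lim (_ @ 0^')); apply/funext => h /=.
by rewrite /shift /= addr0 scale0r add0r [_ *: 1]mulr1.
Qed.

(** Smoothness asks for all iterated partial derivatives; instead of computing
    them, one exhibits an algebra of continuous functions that is stable under
    every partial derivative. *)
Inductive flat_algebra (c : R) : ('rV[R]_n -> R) -> Prop :=
| flat_algebra_cst a : flat_algebra c (cst a)
| flat_algebra_flat i s a P : flat_algebra c (fun x => flat c P (s * x ord0 i + a))
| flat_algebraD f g : flat_algebra c f -> flat_algebra c g -> flat_algebra c (f + g)
| flat_algebraM f g : flat_algebra c f -> flat_algebra c g -> flat_algebra c (f * g).

Lemma is_derive_flat_coord c i s a P j x : 0 < c ->
  is_derive x (delta_mx ord0 j) (fun x => flat c P (s * x ord0 i + a))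
    (s * (i == j)%:R * flat c ('X^2 * (c *: P - P^`())) (s * x ord0 i + a)).
Proof.
move=> c0; apply: is_derive_line.
pose k := s * (i == j)%:R.
rewrite (_ : (fun h : R => _) = flat c P \o (fun h => k * h + (s * x ord0 i + a))); last first.
  by apply/funext => h /=; rewrite !mxE eqxx /k /=; congr flat; ring.
have h1 : is_derive (0 : R) 1 (fun h : R => k * h + (s * x ord0 i + a)) k.
  change (is_derive (0 : R) 1 (k *: id + cst (s * x ord0 i + a)) k).
  apply: is_derive_eq.
  by rewrite addr0 [_ *: 1]mulr1.
have h2 := is_derive_flat P (k * 0 + (s * x ord0 i + a)) c0.
have dc := @is_derive1_comp _ (flat c P) (fun h => k * h + (s * x ord0 i + a)) 0 _ _ h2 h1.
by apply: (is_derive_eq dc); rewrite mulr0 add0r mulrC.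
Qed.

Lemma flat_algebra_partial c f : 0 < c -> flat_algebra c f -> forall j,
  (forall x, derivable f x (delta_mx ord0 j)) /\ flat_algebra c (partial j f).
Proof.
move=> c0; elim=> {f} [a|i s a P|f g _ IHf _ IHg|f g ff IHf fg IHg] j.
- split; first by move=> x; exact: derivable_cst.
  rewrite (_ : partial _ _ = cst 0); first exact: flat_algebra_cst.
  by apply/funext => x; rewrite /partial derive_cst.
- split; first by move=> x; have := is_derive_flat_coord i s a P j x c0; case.
  rewrite (_ : partial _ _ = cst (s * (i == j)%:R) *
      (fun x => flat c ('X^2 * (c *: P - P^`())) (s * x ord0 i + a))).
    by apply: flat_algebraM; [exact: flat_algebra_cst|exact: flat_algebra_flat].
  apply/funext => x; rewrite /partial.
  by have [_ ->] := is_derive_flat_coord i s a P j x c0.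
- have [df pf] := IHf j; have [dg pg] := IHg j.
  split; first by move=> x; exact: derivableD.
  rewrite (_ : partial _ _ = partial j f + partial j g); first exact: flat_algebraD.
  by apply/funext => x; rewrite /partial deriveD.
- have [df pf] := IHf j; have [dg pg] := IHg j.
  split; first by move=> x; exact: derivableM.
  rewrite (_ : partial _ _ = f * partial j g + g * partial j f).
    by apply: flat_algebraD; exact: flat_algebraM.
  by apply/funext => x; rewrite /partial deriveM.
Qed.

Lemma flat_algebra_continuous c f : 0 < c -> flat_algebra c f -> continuous f.
Proof.
move=> c0; elim=> {f} [a|i s a P|f g _ IHf _ IHg|f g ff IHf fg IHg] x.
- exact: cst_continuous.
- apply: (@continuous_comp _ _ _ (fun x : 'rV[R]_n => s * x ord0 i + a) (flat c P)).
    apply: continuousD; last exact: cst_continuous.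
    by apply: continuousM; [exact: cst_continuous|exact: coord_continuous].
  apply/differentiable_continuous/derivable1_diffP.
  by have [] := is_derive_flat P (s * x ord0 i + a) c0.
- by apply: continuousD; [exact: IHf|exact: IHg].
- by apply: continuousM; [exact: IHf|exact: IHg].
Qed.

Lemma flat_algebra_smooth c f : 0 < c -> flat_algebra c f -> smooth f.
Proof.
move=> c0 ff s; have fs : flat_algebra c (foldr partial f s).
  by elim: s => //= i s IH; have [] := flat_algebra_partial c0 IH i.
split; first exact: flat_algebra_continuous fs.
by move=> i; have [] := flat_algebra_partial c0 fs i.
Qed.

(** A bump that is positive exactly on the open box. Letting [c] tend to 0 flattens
    it to the indicator function of the box, with no need for cut-off functions or
    mollification. *)
Definition box_bump c (a b : 'I_n -> R) : 'rV[R]_n -> R := fun x =>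
  \prod_i (flat c 1 (x ord0 i - a i) * flat c 1 (b i - x ord0 i)).

Lemma box_bump_smooth c a b : 0 < c -> smooth (box_bump c a b).
Proof.
move=> c0; apply: (flat_algebra_smooth c0).
rewrite (_ : box_bump c a b = \prod_i ((fun x => flat c 1 (1 * x ord0 i + - a i)) *
   (fun x => flat c 1 (-1 * x ord0 i + b i)))).
  apply: big_ind => [||i _]; first exact: flat_algebra_cst.
    exact: flat_algebraM.
  by apply: flat_algebraM; exact: flat_algebra_flat.
apply/funext => x; rewrite fct_prodE; apply: eq_bigr => i _ /=.
by congr (_ * _); congr flat; ring.
Qed.

Lemma box_bump01 c a b x : 0 <= c -> 0 <= box_bump c a b x <= 1.
Proof.
move=> c0; have h i : 0 <= flat c 1 (x ord0 i - a i) * flat c 1 (b i - x ord0 i) <= 1.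
  have /andP[? ?] := flat01 (x ord0 i - a i) c0.
  have /andP[? ?] := flat01 (b i - x ord0 i) c0.
  by rewrite mulr_ge0//= mulr_ile1.
rewrite prodr_ge0/=; last by move=> i _; case/andP: (h i).
by apply: prodr_ile1 => i _; exact: h.
Qed.

Lemma box_bump_out c a b x : ~ obox a b x -> box_bump c a b x = 0.
Proof.
move=> /existsNP[i /negP]; rewrite negb_and -!leNgt => hx.
rewrite /box_bump (bigD1 i)//=; apply/eqP; rewrite mulf_eq0; apply/orP; left; apply/eqP.
case/orP: hx => hx; first by rewrite (@flat_eq0 _ _ _ (x ord0 i - a i)) ?mul0r ?subr_le0.
by rewrite (@flat_eq0 _ _ _ (b i - x ord0 i)) ?mulr0 ?subr_le0.
Qed.

Lemma cvg_box_bump a b x : obox a b x -> box_bump j.+1%:R^-1 a b x @[j --> \oo] --> (1 : R).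
Proof.
move=> ob; rewrite /box_bump.
rewrite [X in _ --> X](_ : _ = \prod_(i < n) (1 : R)); last by rewrite big1.
apply: (cvg_big mul_continuous) => i _; have /andP[ax xb] := ob i.
have := cvgM (@cvg_flat R (x ord0 i - a i) _) (@cvg_flat R (b i - x ord0 i) _).
by rewrite mulr1 !subr_gt0; apply.
Qed.

End bumps.

(** * Complex-valued integrals *)

Section complex_parts.
Context {R : rcfType}.
Implicit Types z w : R[i].
Lemma complexReD z w : complex.Re (z + w) = complex.Re z + complex.Re w.
Proof. by case: z; case: w. Qed.
Lemma complexImD z w : complex.Im (z + w) = complex.Im z + complex.Im w.
Proof. by case: z; case: w. Qed.
Lemma complexReM z w : complex.Re (z * w) =
  complex.Re z * complex.Re w - complex.Im z * complex.Im w.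
Proof. by case: z; case: w. Qed.
Lemma complexImM z w : complex.Im (z * w) =
  complex.Re z * complex.Im w + complex.Im z * complex.Re w.
Proof. by case: z; case: w. Qed.
End complex_parts.

Section complex_integral.
Context {R : realType} {n : nat}.
Local Notation leb := (lebesgue_rV n).
Implicit Types (D : set 'rV[R]_n) (f g u v w : 'rV[R]_n -> R[i]) (c : R[i]).

Lemma cintegrableD D f g : measurable D -> cintegrable D f -> cintegrable D g ->
  cintegrable D (fun x => f x + g x).
Proof.
move=> mD [f1 f2] [g1 g2]; split.
- have := integrableD mD f1 g1; apply: eq_integrable => // x _.
  by rewrite /= /re complexReD EFinD.
- have := integrableD mD f2 g2; apply: eq_integrable => // x _.
  by rewrite /= /im complexImD EFinD.
Qed.

Lemma cintegrableZ D c f : measurable D -> cintegrable D f ->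
  cintegrable D (fun x => c * f x).
Proof.
move=> mD [f1 f2]; split.
- have := integrableB mD (integrableZl mD (complex.Re c) f1) (integrableZl mD (complex.Im c) f2).
  apply: eq_integrable => // x _.
  by rewrite /= /re complexReM EFinB !EFinM.
- have := integrableD mD (integrableZl mD (complex.Re c) f2) (integrableZl mD (complex.Im c) f1).
  apply: eq_integrable => // x _.
  by rewrite /= /im complexImM EFinD !EFinM.
Qed.

Lemma cintegrable0 D : measurable D -> cintegrable D (fun=> 0 : R[i]).
Proof.
by move=> mD; split; exact: integrable0.
Qed.

Lemma eq_cintegral D f g : {in D, f =1 g} -> cintegral D f = cintegral D g.
Proof.
move=> fg; rewrite /cintegral; congr (_ +i* _)%C; apply: eq_Rintegral => x xD.
- by rewrite /re fg.
- by rewrite /im fg.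
Qed.

Lemma cintegralD D f g : measurable D -> cintegrable D f -> cintegrable D g ->
  cintegral D (fun x => f x + g x) = cintegral D f + cintegral D g.
Proof.
move=> mD [f1 f2] [g1 g2]; rewrite /cintegral /= [RHS]/(_ + _)/=.
congr (_ +i* _)%C.
- by rewrite -RintegralD//; apply: eq_Rintegral => x _; rewrite /re complexReD.
- by rewrite -RintegralD//; apply: eq_Rintegral => x _; rewrite /im complexImD.
Qed.

Lemma cintegralZ D c f : measurable D -> cintegrable D f ->
  cintegral D (fun x => c * f x) = c * cintegral D f.
Proof.
move=> mD [f1 f2]; apply/eqP; rewrite eq_complex complexReM complexImM /=.
rewrite -!RintegralZl// -RintegralB//; first last.
- by have := integrableZl mD (complex.Im c) f2; apply: eq_integrable.
- by have := integrableZl mD (complex.Re c) f1; apply: eq_integrable.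
rewrite -RintegralD//; first last.
- by have := integrableZl mD (complex.Im c) f1; apply: eq_integrable.
- by have := integrableZl mD (complex.Re c) f2; apply: eq_integrable.
by apply/andP; split; apply/eqP; apply: eq_Rintegral => x _; rewrite /re /im ?complexReM ?complexImM.
Qed.

Lemma ae_eq_Rintegral D (f g : 'rV[R]_n -> R) : measurable D ->
  leb.-integrable D (EFin \o f) -> leb.-integrable D (EFin \o g) ->
  f = g %[ae leb in D] ->
  \int[leb]_(x in D) f x = \int[leb]_(x in D) g x.
Proof.
move=> mD /measurable_int mf /measurable_int mg fg; congr fine.
apply: ae_eq_integral => //; apply: filterS fg => x /= + Dx.
by move=> /(_ Dx) ->.
Qed.

Lemma ae_eq_cintegral D f g : measurable D ->
  cintegrable D f -> cintegrable D g -> f = g %[ae leb in D] ->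
  cintegral D f = cintegral D g.
Proof.
move=> mD [f1 f2] [g1 g2] fg; rewrite /cintegral; congr (_ +i* _)%C;
  apply: ae_eq_Rintegral => //; apply: filterS fg => x h Dx;
  by rewrite /re /im h.
Qed.

End complex_integral.

(** * Test functions *)

Section test_functions.
Context {R : realType} {n : nat}.
Local Notation leb := (lebesgue_rV n).
Implicit Types (Om K : set 'rV[R]_n) (h : 'rV[R]_n -> R) (u w phi : 'rV[R]_n -> R[i]).
Implicit Types (al : 'I_n -> nat).

(** On [K] the continuous factor is bounded, and off [K] the product vanishes, so
    local integrability of [f] is enough for integrability on all of [Om]. *)
Lemma integrable_mul_continuous Om K (f h : 'rV[R]_n -> R) :
  measurable Om -> compact K -> K `<=` Om ->
  leb.-integrable K (EFin \o f) -> continuous h -> (forall x, ~ K x -> h x = 0) ->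
  leb.-integrable Om (EFin \o (fun x => f x * h x)).
Proof.
move=> mOm cK KOm fK ch h0; have mK := compact_measurable_rV cK.
have bh : [bounded h x | x in K].
  have : bounded_set (h @` K).
    apply: compact_bounded; apply: continuous_compact => //.
    exact: continuous_subspaceT.
  move=> [M [Mreal bM]]; exists M; split => // r Mr x Kx.
  by apply: (bM r Mr); exists x.
have fhK := integrableMl mK fK (continuous_measurable_rV ch) bh.
have : leb.-integrable Om ((EFin \o (fun x => f x * h x)) \_ K).
  apply/integrable_restrict => //; rewrite setIidr//.
apply: eq_integrable => // x _ /=; rewrite patchE; case: ifPn => //.
by rewrite notin_setE => /h0 ->; rewrite mulr0.
Qed.

(** What the integrals against a test function or against its derivatives use of
    that function. *)
Definition continuous_in (K : set 'rV[R]_n) w :=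
  [/\ continuous (re w), continuous (im w) & forall x, ~ K x -> w x = 0].

Lemma cintegrable_mul Om K u w : measurable Om -> compact K -> K `<=` Om ->
  cintegrable K u -> continuous_in K w -> cintegrable Om (fun x => u x * w x).
Proof.
move=> mOm cK KOm [u1 u2] [w1 w2 w0].
have re0 x : ~ K x -> re w x = 0 by move=> /w0; rewrite /re => ->.
have im0 x : ~ K x -> im w x = 0 by move=> /w0; rewrite /im => ->.
split.
- have := integrableB mOm (integrable_mul_continuous mOm cK KOm u1 w1 re0)
    (integrable_mul_continuous mOm cK KOm u2 w2 im0).
  by apply: eq_integrable => // x _; rewrite /= /re complexReM EFinB.
- have := integrableD mOm (integrable_mul_continuous mOm cK KOm u1 w2 im0)
    (integrable_mul_continuous mOm cK KOm u2 w1 re0).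
  by apply: eq_integrable => // x _; rewrite /= /im complexImM EFinD.
Qed.

Lemma multi_partialE al : exists s, forall h, multi_partial al h = foldr partial h s.
Proof.
rewrite /multi_partial; elim: (enum 'I_n) => [|i s [t IH]]; first by exists [::].
exists (nseq (al i) i ++ t) => h; rewrite /= IH foldr_cat.
by elim: (al i) => //= m ->.
Qed.

(** Differentiation is local, so derivatives vanish on the open complement of [K]. *)
Lemma foldr_partial0 K h (s : seq 'I_n) : closed K -> (forall x, ~ K x -> h x = 0) ->
  forall x, ~ K x -> foldr partial h s x = 0.
Proof.
move=> cK h0; elim: s => //= i s IH x Kx; rewrite /partial.
rewrite (@near_eq_derive _ _ _ _ (cst 0)) ?derive_cst//.
have : nbhs x (~` K) by apply: open_nbhs_nbhs; split => //; exact: closed_openC.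
by apply: filterS => y /IH.
Qed.

Lemma cpartial0 al : cpartial al (fun=> 0 : R[i]) = fun=> 0.
Proof.
apply/funext => x; have [s E] := multi_partialE al.
rewrite /cpartial !E !(@foldr_partial0 set0)//; exact: closed0.
Qed.

Lemma continuous_in_cpartial K al phi : closed K -> csmooth phi ->
  (forall x, ~ K x -> phi x = 0) -> continuous_in K (cpartial al phi).
Proof.
move=> cK [s1 s2] phi0; have [s E] := multi_partialE al; split.
- by have [] := s1 s; rewrite -E.
- by have [] := s2 s; rewrite -E.
- move=> x Kx; rewrite /cpartial !E !(@foldr_partial0 K)//.
    by move=> y /phi0; rewrite /im => ->.
  by move=> y /phi0; rewrite /re => ->.
Qed.

Lemma continuous_in_csmooth K phi : csmooth phi ->
  (forall x, ~ K x -> phi x = 0) -> continuous_in K phi.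
Proof.
by move=> [s1 s2] phi0; split => //; [have [] := s1 [::]|have [] := s2 [::]].
Qed.

Lemma supportP (V : zmodType) (phi : 'rV[R]_n -> V) x :
  ~ closure [set x | phi x != 0] x -> phi x = 0.
Proof.
move=> h; apply/eqP; apply: contrapT => /negP phix; apply: h.
exact: subset_closure.
Qed.

Lemma cintegrable_test Om u phi : measurable Om -> L1loc Om u -> test_function Om phi ->
  cintegrable Om (fun x => u x * phi x).
Proof.
move=> mOm lu [sphi [cK KOm]]; apply: cintegrable_mul cK KOm (lu _ cK KOm) _ => //.
by apply: continuous_in_csmooth => // x; exact: supportP.
Qed.

Lemma cintegrable_test_partial Om u al phi : measurable Om -> L1loc Om u ->
  test_function Om phi -> cintegrable Om (fun x => u x * cpartial al phi x).
Proof.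
move=> mOm lu [sphi [cK KOm]]; apply: cintegrable_mul cK KOm (lu _ cK KOm) _ => //.
apply: continuous_in_cpartial => //; first exact: closed_closure.
by move=> x; exact: supportP.
Qed.

End test_functions.

(** * The fundamental lemma of the calculus of variations *)

Section orthants.
Context {R : realType} {n : nat}.

(** Unbounded sides are allowed so that the preimage of a half-line under a single
    coordinate is an orthant; these sets then form a pi-system that generates the
    sigma-algebra and cuts boxes into boxes. *)
Definition half_line : set (set R) := [set X | X = setT \/ exists r, X = `]r, +oo[%classic].

Definition orthant : set (set 'rV[R]_n) :=
  [set E | exists2 C : 'I_n -> set R, (forall i, half_line (C i)) &
    E = [set x : 'rV[R]_n | forall i, C i (x ord0 i)]].

Lemma half_lineI : setI_closed half_line.
Proof.
move=> X Y [->|[r ->]] [->|[s ->]]; rewrite ?setTI ?setIT; [by left|by right; exists s|by right; exists r|right].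
exists (Num.max r s); apply/seteqP; split => x /=; rewrite !in_itv/= !andbT gt_max.
  by move=> [-> ->].
by move=> /andP.
Qed.

Lemma orthantI : setI_closed orthant.
Proof.
move=> _ _ [C hC ->] [D hD ->]; exists (fun i => C i `&` D i).
  by move=> i; exact: half_lineI.
apply/seteqP; split => x /=; first by move=> [h1 h2] i; split.
by move=> h; split => i; have [] := h i.
Qed.

Lemma measurable_orthant (E : set 'rV[R]_n) : measurable E -> <<s orthant >> E.
Proof.
apply: smallest_sub; first by [].
apply: (big_ind (fun X => X `<=` <<s orthant >>)) => // [X Y hX hY Z [/hX|/hY]//|i _].
rewrite [X in preimage_set_system _ _ X](_ : _ =
   (RGenOInfty.G (R := R)).-sigma.-measurable); last first.
  exact: RGenOInfty.measurableE.
rewrite -g_sigma_preimageE; apply: sub_sigma_algebra2 => _ [_ [r ->] <-].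
exists (fun j => if j == i then `]r, +oo[%classic else setT).
  by move=> j; case: ifP => _; [right; exists r|left].
rewrite setTI; apply/seteqP; split => x /=.
  by move=> h j; case: eqP => // ->.
by move=> /(_ i); rewrite eqxx.
Qed.

End orthants.

Section fundamental_lemma.
Context {R : realType} {n : nat}.
Local Notation leb := (lebesgue_rV n).
Implicit Types (f : 'rV[R]_n -> R) (a b : 'I_n -> R) (E : set 'rV[R]_n).

(** Only the lower corner moves, so the smaller box has its closure in every set
    that contains the closure of the larger one. *)
Lemma orthant_obox a b E : orthant E -> exists2 a', (forall i, a i <= a' i) &
  E `&` obox a b = obox a' b.
Proof.
move=> [C hC ->]; have /choice[a' a'P] : forall i, exists r, a i <= r /\
    forall t, (C i t /\ a i < t) <-> r < t.
  move=> i; case: (hC i) => [->|[r ->]]; first by exists (a i); split => // t; split => [[]|].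
  exists (Num.max (a i) r); split; first by rewrite le_max lexx.
  move=> t; rewrite /= in_itv/= andbT gt_max; split => [[-> ->]//|/andP[-> ->]//].
exists a' => [i|]; first by have [] := a'P i.
apply/seteqP; split => x /=.
  by move=> [Cx ob] i; have /andP[ax ->] := ob i; rewrite andbT; apply/(a'P i).2.
move=> h; split => i; have /andP[ax xb] := h i; have [Cx ax'] := ((a'P i).2 _).2 ax => //.
by rewrite ax'.
Qed.

(** The sets on which [f] has integral 0 form a lambda-system; as it contains the
    orthants, the pi-lambda theorem gives all measurable subsets of
    the box. *)
Lemma integral_boxes0_ae f a b : leb.-integrable (obox a b) (EFin \o f) ->
  (forall a', (forall i, a i <= a' i) -> (\int[leb]_(x in obox a' b) (f x)%:E = 0)%E) ->
  f = (fun=> 0) %[ae leb in obox a b].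
Proof.
move=> intf f0; have mB := @obox_measurable R n a b; set B := obox a b in mB intf *.
have mf := measurable_int _ intf.
have key E : measurable E -> (\int[leb]_(x in E `&` B) (f x)%:E = 0)%E.
  pose H := [set E | measurable E /\ (\int[leb]_(x in E `&` B) (f x)%:E = 0)%E].
  move=> /measurable_orthant; suff : <<s orthant >> `<=` H by move=> h /h[].
  move=> {E}.
  apply: lambda_system_subset => //; first exact: orthantI; last first.
    move=> E oE; split; last by have [a' aa' ->] := orthant_obox a b oE; exact: f0.
    have [C hC ->] := oE; apply: (@box_measurable R n C) => i.
    by case: (hC i) => [->|[r ->]]; [exact: measurableT|exact: measurable_itv].
  apply/dynkin_lambda_system; split.
  - by split; [exact: measurableT|rewrite setTI; exact: f0].
  - move=> E [mE E0]; split; first exact: measurableC.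
    have : (\int[leb]_(x in B) (f x)%:E = 0)%E by exact: f0.
    rewrite -[X in integral _ X _](setUIDK B E).
    rewrite integral_setU//; first last.
    + by apply/eqP/seteqP; split => // x [[_ Ex] [_ nEx]].
    + by rewrite setUIDK.
    + exact: measurableD.
    + exact: measurableI.
    by rewrite setIC E0 add0e setDE setIC.
  - move=> F tF HF; have mF k : measurable (F k) by have [] := HF k.
    split; first exact: bigcupT_measurable.
    rewrite setI_bigcupl integral_bigcup.
    + by apply: eseries0 => k _ _; have [] := HF k.
    + exact: trivIset_setIr.
    + by move=> k; exact: measurableI.
    + apply: integrableS intf => //.
        by apply: bigcupT_measurable => k; exact: measurableI.
      by apply: bigcup_sub => k _; exact: subIsetr.
have : ae_eq leb B (EFin \o f) (cst 0%E).
  apply: integral_ae_eq => // E EB mE; rewrite integral0 -[RHS](key E mE).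
  by rewrite setIidl.
by apply: filterS => x h /h [].
Qed.

(** Dominated convergence along [c = 1 / (j + 1)], with dominating function |f|,
    since the bumps take their values in [0, 1]. *)
Lemma integral_obox_limit f a b (Om : set 'rV[R]_n) : measurable Om ->
  cbox a b `<=` Om -> leb.-integrable (cbox a b) (EFin \o f) ->
  (forall c, 0 < c -> (\int[leb]_(x in Om) (f x * box_bump c a b x)%:E = 0)%E) ->
  (\int[leb]_(x in obox a b) (f x)%:E = 0)%E.
Proof.
move=> mOm abO intf f0; have mB := @obox_measurable R n a b.
have mC := compact_measurable_rV (cbox_compact a b).
have intB : leb.-integrable (obox a b) (EFin \o f).
  by apply: integrableS intf => //; exact: obox_cbox.
have mf := measurable_int _ intB.
have c0 j : 0 < j.+1%:R^-1 :> R by rewrite invr_gt0.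
have cb j : continuous (box_bump j.+1%:R^-1 a b) by have [] := box_bump_smooth a b (c0 j) [::].
have [|||||_ _] := @dominated_convergence _ _ _ leb (obox a b) mB
   (fun j x => (f x * box_bump j.+1%:R^-1 a b x)%:E) (EFin \o f) (abse \o (EFin \o f)).
- move=> j; apply/measurable_EFinP; apply: measurable_funM.
    exact/measurable_EFinP.
  exact: continuous_measurable_rV.
- exact: mf.
- apply: aeW => x ob; apply: cvg_EFin; first exact: nearW.
  by rewrite -[X in _ --> X]mulr1; apply: cvgM; [exact: cvg_cst|exact: cvg_box_bump].
- exact: integrable_abse.
- apply: aeW => x j ob /=; rewrite lee_fin normrM ler_piMr//.
  have /andP[b0 b1] := box_bump01 a b x (ltW (c0 j)).
  by rewrite ger0_norm.
move=> /cvg_lim <- //; rewrite (_ : [sequence _]_n = cst 0%E) ?lim_cst//.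
apply/funext => j /=; rewrite -(f0 _ (c0 j)).
rewrite -[in LHS](setIidr (subset_trans (@obox_cbox R n a b) abO)) integral_mkcondr.
apply: eq_integral => x _; rewrite patchE; case: ifPn => //.
by rewrite notin_setE => /box_bump_out ->; rewrite mulr0.
Qed.

Lemma box_bump_test_function (Om : set 'rV[R]_n) c a b : 0 < c -> cbox a b `<=` Om ->
  test_function Om (fun x => (box_bump c a b x)%:C%C).
Proof.
move=> c0 abO; split.
  split; first exact: box_bump_smooth.
  move=> s; have -> : foldr partial (im (fun x => (box_bump c a b x)%:C%C)) s = cst 0.
    apply/funext => x; exact: (@foldr_partial0 _ _ set0 _ _ closed0).
  by split => [|i x]; [exact: cst_continuous|exact: derivable_cst].
have sub : closure [set x | (box_bump c a b x)%:C%C != 0] `<=` cbox a b.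
  have /closure_id -> : closed (cbox a b).
    exact: (compact_closed (@norm_hausdorff _ _) (cbox_compact a b)).
  apply: closureS => x /= bn0; apply: obox_cbox; apply: contrapT => /box_bump_out b0.
  by move: bn0; rewrite b0 eqxx.
split; last exact: subset_trans abO.
apply: subclosed_compact (cbox_compact a b) sub; exact: closed_closure.
Qed.

(** The conclusion holds on each of countably many boxes that cover [Om], hence on
    [Om]. *)
Lemma real_du_Bois_Reymond (Om : set 'rV[R]_n) f : open Om ->
  (forall K, compact K -> K `<=` Om -> leb.-integrable K (EFin \o f)) ->
  (forall c a b, 0 < c -> cbox a b `<=` Om ->
     (\int[leb]_(x in Om) (f x * box_bump c a b x)%:E = 0)%E) ->
  f = (fun=> 0) %[ae leb in Om].
Proof.
move=> oOm locf f0; have mOm := open_measurable_rV oOm.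
have [J [a [b [abO OmE]]]] := open_bigcup_boxes oOm.
have box0 j : J j -> f = (fun=> 0) %[ae leb in obox (a j) (b j)].
  move=> /abO sub; apply: integral_boxes0_ae.
    apply: (@integrableS _ _ _ _ (cbox (a j) (b j))).
    - exact: compact_measurable_rV (cbox_compact _ _).
    - exact: obox_measurable.
    - exact: obox_cbox.
    - by apply: locf => //; exact: (cbox_compact _ _).
  move=> a' aa'; have sub' : cbox a' (b j) `<=` Om.
    apply: subset_trans sub => x h i; have /andP[h1 ->] := h i.
    by rewrite andbT (le_trans (aa' i)).
  apply: (integral_obox_limit mOm sub').
    by apply: locf => //; exact: (cbox_compact _ _).
  by move=> c c0; exact: f0.
have : \forall x \ae leb, forall j, J j -> obox (a j) (b j) x -> f x = 0.
  apply: ae_foralln => j; have [Jj|nJj] := pselect (J j); last exact: aeW.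
  have := box0 j Jj; apply: filterS => x h _; exact: h.
by apply: filterS => x h; rewrite OmE => -[j /= Jj /(h j Jj)].
Qed.

(** The bumps are real-valued, so testing against them separates real and imaginary
    part. *)
Lemma du_Bois_Reymond (Om : set 'rV[R]_n) (g : 'rV[R]_n -> R[i]) : open Om ->
  L1loc Om g ->
  (forall phi, test_function Om phi -> cintegral Om (fun x => g x * phi x) = 0) ->
  g = (fun=> 0) %[ae leb in Om].
Proof.
move=> oOm lg g0; have mOm := open_measurable_rV oOm.
have bumpE c a b : 0 < c -> cbox a b `<=` Om ->
    (\int[leb]_(x in Om) (re g x * box_bump c a b x)%:E = 0)%E /\
    (\int[leb]_(x in Om) (im g x * box_bump c a b x)%:E = 0)%E.
  move=> c0 abO; have tb := box_bump_test_function c0 abO.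
  have [i1 i2] := cintegrable_test mOm lg tb.
  move: (g0 _ tb) => /eqP; rewrite eq_complex /= => /andP[/eqP h1 /eqP h2].
  have e1 : re (fun x => g x * (box_bump c a b x)%:C%C) = fun x => re g x * box_bump c a b x.
    by apply/funext => x; apply: etrans (complexReM _ _) _; rewrite /= mulr0 subr0.
  have e2 : im (fun x => g x * (box_bump c a b x)%:C%C) = fun x => im g x * box_bump c a b x.
    by apply/funext => x; apply: etrans (complexImM _ _) _; rewrite /= mulr0 add0r.
  rewrite e1 in i1 h1; rewrite e2 in i2 h2; split.
    by rewrite -[LHS]fineK ?(integrable_fin_num mOm i1)//; congr EFin.
  by rewrite -[LHS]fineK ?(integrable_fin_num mOm i2)//; congr EFin.
have h1 : re g = (fun=> 0) %[ae leb in Om].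
  apply: real_du_Bois_Reymond => // [K cK KO|c a b c0 abO].
    by have [] := lg K cK KO.
  by have [] := bumpE c a b c0 abO.
have h2 : im g = (fun=> 0) %[ae leb in Om].
  apply: real_du_Bois_Reymond => // [K cK KO|c a b c0 abO].
    by have [] := lg K cK KO.
  by have [] := bumpE c a b c0 abO.
apply: filterS2 h1 h2 => x e1 e2 Ox; apply/eqP; rewrite eq_complex /=.
by move: (e1 Ox) (e2 Ox); rewrite /re /im => -> ->; rewrite eqxx.
Qed.

End fundamental_lemma.

(** * Weak derivatives of complex-valued functions *)

Section weak_derivatives.
Context {R : realType} {n : nat} (Om : set 'rV[R]_n) (oOm : open Om).
Local Notation leb := (lebesgue_rV n).
Implicit Types (u v g h : 'rV[R]_n -> R[i]) (c : R[i]) (al : 'I_n -> nat).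

Let mOm : measurable Om := open_measurable_rV oOm.

Lemma L1locD u v : L1loc Om u -> L1loc Om v -> L1loc Om (fun x => u x + v x).
Proof.
move=> lu lv K cK KO; apply: cintegrableD; first exact: compact_measurable_rV.
  exact: lu.
exact: lv.
Qed.

Lemma L1locZ c u : L1loc Om u -> L1loc Om (fun x => c * u x).
Proof.
move=> lu K cK KO; apply: cintegrableZ; first exact: compact_measurable_rV.
exact: lu.
Qed.

Lemma L1loc0 : L1loc Om (fun=> 0).
Proof. by move=> K cK KO; apply: cintegrable0; exact: compact_measurable_rV. Qed.

(** [Om] is a countable union of boxes with compact closure in [Om]. *)
Lemma L1loc_cmeasurable u : L1loc Om u -> cmeasurable Om u.
Proof.
move=> lu; have [J [a [b [abO OmE]]]] := open_bigcup_boxes oOm.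
pose E j := if `[< J j >] then obox (a j) (b j) else set0.
have mE j : measurable (E j).
  by rewrite /E; case: asboolP => _; [exact: obox_measurable|exact: measurable0].
have -> : Om = \bigcup_j E j.
  rewrite OmE; apply/seteqP; split => x [j Jj xj]; exists j => //.
    by rewrite /E asboolT.
  by move: xj; rewrite /E; case: asboolP.
  by move: xj; rewrite /E; case: asboolP.
suff lE j : cmeasurable (E j) u.
  by split; apply/measurable_fun_bigcup => // j; have [] := lE j.
rewrite /E; case: asboolP => [Jj|_]; last by split; exact: measurable_fun_set0.
have [u1 u2] := lu _ (cbox_compact (a j) (b j)) (abO j Jj).
have sub := @obox_cbox R n (a j) (b j).
have mC : measurable (cbox (a j) (b j)) := compact_measurable_rV (cbox_compact (a j) (b j)).
split; apply: (measurable_funS mC sub); apply/measurable_EFinP.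
  exact: measurable_int u1.
exact: measurable_int u2.
Qed.

Lemma weak_derivative_linear al c u v g h :
  is_weak_derivative Om al u g -> is_weak_derivative Om al v h ->
  is_weak_derivative Om al (fun x => c * u x + v x) (fun x => c * g x + h x).
Proof.
move=> [lu lg ug] [lv lh vh]; split; [exact/L1locD/lv/L1locZ|exact/L1locD/lh/L1locZ|].
move=> phi tphi.
have iu := cintegrable_test_partial al mOm lu tphi.
have iv := cintegrable_test_partial al mOm lv tphi.
have ig := cintegrable_test mOm lg tphi.
have ih := cintegrable_test mOm lh tphi.
under eq_fun do rewrite mulrDl -mulrA.
under [in RHS]eq_fun do rewrite mulrDl -mulrA.
rewrite !cintegralD//; try exact: cintegrableZ.
by rewrite !cintegralZ// ug// vh// mulrDr [in RHS]mulrCA.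
Qed.

Lemma weak_derivative0 al : is_weak_derivative Om al (fun=> 0) (fun=> 0).
Proof.
split; [exact: L1loc0|exact: L1loc0|move=> phi tphi].
have I0 (w : 'rV[R]_n -> R[i]) : cintegral Om (fun x => 0 * w x) = 0.
  rewrite -[RHS](mul0r (cintegral Om (fun=> 0))) -cintegralZ//; last exact: cintegrable0.
  by apply: eq_cintegral => x _; rewrite !mul0r.
by rewrite !I0 mulr0.
Qed.

(** Both derivatives have the same integrals against all test functions, so the
    fundamental lemma applies to their difference. *)
Lemma weak_derivative_unique al u v g h : u = v %[ae leb in Om] ->
  is_weak_derivative Om al u g -> is_weak_derivative Om al v h ->
  g = h %[ae leb in Om].
Proof.
move=> uv [lu lg ug] [lv lh vh].
have lgh : L1loc Om (fun x => g x + -1 * h x) by apply: L1locD => //; exact: L1locZ.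
suff : (fun x => g x + -1 * h x) = (fun=> 0) %[ae leb in Om].
  by apply: filterS => x /[apply] /eqP; rewrite mulN1r subr_eq0 => /eqP.
apply: du_Bois_Reymond => // phi tphi.
have ig := cintegrable_test mOm lg tphi.
have ih := cintegrable_test mOm lh tphi.
under eq_fun do rewrite mulrDl -mulrA.
rewrite cintegralD//; last exact: cintegrableZ.
rewrite cintegralZ// mulN1r; apply/eqP; rewrite subr_eq0; apply/eqP.
apply: (@mulfI _ ((-1) ^+ mdeg al)); first by rewrite signr_eq0.
rewrite -ug// -vh//; apply: ae_eq_cintegral => //; try exact: cintegrable_test_partial.
by apply: filterS uv => x h1 Ox; rewrite h1.
Qed.

End weak_derivatives.

(** * Weak derivatives in coordinates *)

Section fuzzy_weak_derivatives.
Context {R : realType} {A : fuzzy_number R} {hA : asymmetric A}.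
Context {n : nat} (Om : set 'rV[R]_n) (oOm : open Om).
Local Notation m := ((midpoint A)%:C%C).
Implicit Types (F G : 'rV[R]_n -> CFA hA) (x y : CFA hA) (al : 'I_n -> nat).

Let mOm : measurable Om := open_measurable_rV oOm.

Lemma psi_inv_linear (l : R[i]) x y : psi_inv (l *: x + y) = l *: psi_inv x + psi_inv y.
Proof. by rewrite -[x in LHS]psi_invK -[y in LHS]psi_invK -psiZ -psiD psiK. Qed.

Lemma psi0 : psi (0, 0) = 0 :> CFA hA.
Proof. by []. Qed.

Lemma psi_inv0 : psi_inv (0 : CFA hA) = (0, 0).
Proof. by rewrite -psi0 psiK. Qed.

Lemma psi_inv_cross x y : let: (u, v) := psi_inv x in let: (z, w) := psi_inv y in
  psi_inv (cross x y) =
  (u * z + - m ^+ 2 * (v * w), u * w + (v * z + 2 * m * (v * w))).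
Proof.
rewrite /cross; case: (psi_inv x) => u v; case: (psi_inv y) => z w.
by rewrite psiK mulNr -addrA [z * v]mulrC.
Qed.

Lemma coordu_cross F G : coordu (fun t => cross (F t) (G t)) =
  fun t => coordu F t * coordu G t + - m ^+ 2 * (coordv F t * coordv G t).
Proof.
apply/funext => t; rewrite /coordu /coordv; have := psi_inv_cross (F t) (G t).
by case: (psi_inv (F t)) => u v; case: (psi_inv (G t)) => z w ->.
Qed.

Lemma coordv_cross F G : coordv (fun t => cross (F t) (G t)) =
  fun t => coordu F t * coordv G t +
    (coordv F t * coordu G t + 2 * m * (coordv F t * coordv G t)).
Proof.
apply/funext => t; rewrite /coordu /coordv; have := psi_inv_cross (F t) (G t).
by case: (psi_inv (F t)) => u v; case: (psi_inv (G t)) => z w ->.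
Qed.

Lemma coordu_partial al F : coordu (fuzzy_partial al F) = cpartial al (coordu F).
Proof. by apply/funext => t; rewrite /coordu /fuzzy_partial psiK. Qed.

Lemma coordv_partial al F : coordv (fuzzy_partial al F) = cpartial al (coordv F).
Proof. by apply/funext => t; rewrite /coordv /fuzzy_partial psiK. Qed.

Lemma coordu_psi (u v : 'rV[R]_n -> R[i]) :
  coordu (fun t => psi (u t, v t) : CFA hA) = u.
Proof. by apply/funext => t; rewrite /coordu psiK. Qed.

Lemma coordv_psi (u v : 'rV[R]_n -> R[i]) :
  coordv (fun t => psi (u t, v t) : CFA hA) = v.
Proof. by apply/funext => t; rewrite /coordv psiK. Qed.

Lemma csmooth0 : csmooth ((fun=> 0) : 'rV[R]_n -> R[i]).
Proof.
have h s : foldr partial (fun=> 0) s = (fun=> 0) :> ('rV[R]_n -> R).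
  by apply/funext => x; exact: (@foldr_partial0 _ _ set0 _ _ closed0).
by split=> s; rewrite /re /im /= h; split => [|i x]; [exact: cst_continuous|exact: derivable_cst|exact: cst_continuous|exact: derivable_cst].
Qed.

Lemma fuzzy_test_function_psi phi : test_function Om phi ->
  fuzzy_test_function Om (fun t => psi (phi t, 0) : CFA hA).
Proof.
move=> [sphi cphi]; split; first by rewrite coordu_psi.
  by rewrite coordv_psi; exact: csmooth0.
rewrite /compact_support (_ : [set x | _] = [set x | phi x != 0])//.
apply/seteqP; split => x /=; apply: contra_neq; first by move=> ->; exact: psi0.
by move=> /(congr1 psi_inv); rewrite psiK psi_inv0 => -[].
Qed.

Lemma fuzzy_test_function_coord Phi : fuzzy_test_function Om (Phi : _ -> CFA hA) ->
  test_function Om (coordu Phi) /\ test_function Om (coordv Phi).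
Proof.
move=> [su sv [cK KO]].
have sub (f : CFA hA -> R[i]) : f 0 = 0 ->
    compact_support Om (fun t => f (Phi t)).
  move=> f0; have s : closure [set x | f (Phi x) != 0] `<=` closure [set x | Phi x != 0].
    by apply: closureS => x /=; apply: contra_neq => ->.
  split; last exact: subset_trans KO.
  by apply: subclosed_compact cK s; exact: closed_closure.
split; split => //; first by apply: (sub (fun z => (psi_inv z).1)); rewrite psi_inv0.
by apply: (sub (fun z => (psi_inv z).2)); rewrite psi_inv0.
Qed.


(** For a test function phi + 0A the two coordinates of the identity are the
    identities for u and v against phi. Conversely, the coordinates of the identity
    for a general test function are linear combinations of the identities for u and
    v against its two coordinates; the integrals may be split because each product
    is integrable by [cintegrable_test] and [cintegrable_test_partial]. *)
Lemma fuzzy_weak_derivativeP al F G : is_fuzzy_weak_derivative Om al F G <->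
  is_weak_derivative Om al (coordu F) (coordu G) /\
  is_weak_derivative Om al (coordv F) (coordv G).
Proof.
split=> [[lF lG FG]|[[lu lgu wu] [lv lgv wv]]].
  have H phi : test_function Om phi ->
    cintegral Om (fun t => coordu F t * cpartial al phi t) =
      (-1) ^+ mdeg al * cintegral Om (fun t => coordu G t * phi t) /\
    cintegral Om (fun t => coordv F t * cpartial al phi t) =
      (-1) ^+ mdeg al * cintegral Om (fun t => coordv G t * phi t).
    move=> /fuzzy_test_function_psi/FG; rewrite /fuzzy_integral -psiZ => /psi_inj [].
    rewrite !coordu_cross !coordv_cross coordu_partial coordv_partial.
    rewrite !coordu_psi !coordv_psi cpartial0.
    under eq_fun do rewrite !mulr0 addr0.
    under [in X in _ = _ *: X -> _]eq_fun do rewrite !mulr0 addr0.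
    move=> e1.
    under eq_fun do rewrite !mulr0 add0r addr0.
    under [in X in _ = _ *: X -> _]eq_fun do rewrite !mulr0 add0r addr0.
    by move=> e2.
  split; split.
  - by move=> K cK KO; have [] := lF K cK KO.
  - by move=> K cK KO; have [] := lG K cK KO.
  - by move=> phi /H[].
  - by move=> K cK KO; have [] := lF K cK KO.
  - by move=> K cK KO; have [] := lG K cK KO.
  - by move=> phi /H[].
split.
- by move=> K cK KO; split; [exact: lu|exact: lv].
- by move=> K cK KO; split; [exact: lgu|exact: lgv].
move=> Phi tPhi; have [tu tv] := fuzzy_test_function_coord tPhi.
rewrite /fuzzy_integral -psiZ !coordu_cross !coordv_cross coordu_partial coordv_partial.
have iu1 := cintegrable_test_partial al mOm lu tu.
have iu2 := cintegrable_test_partial al mOm lu tv.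
have iv1 := cintegrable_test_partial al mOm lv tu.
have iv2 := cintegrable_test_partial al mOm lv tv.
have jgu1 := cintegrable_test mOm lgu tu.
have jgu2 := cintegrable_test mOm lgu tv.
have jgv1 := cintegrable_test mOm lgv tu.
have jgv2 := cintegrable_test mOm lgv tv.
rewrite !(cintegralD mOm)//; try (by repeat (apply: cintegrableD || apply: cintegrableZ)).
rewrite !cintegralZ//.
rewrite (wu _ tu) (wu _ tv) (wv _ tu) (wv _ tv).
congr psi; congr pair => /=.
  by rewrite [RHS]mulrDr [in RHS]mulrCA.
by rewrite [RHS]mulrDr [in RHS]mulrDr [X in _ = _ + (_ + X)]mulrCA.
Qed.

End fuzzy_weak_derivatives.

(** * Comparison of the norms *)

Section real_Lp.
Context {R : realType} d (T : measurableType d) (mu : {measure set T -> \bar R}).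
Context (D : set T) (mD : measurable D).
Implicit Types (f g h : T -> R) (p C : R).

(** The complex and the fuzzy norm are both of this form, for f the pointwise norm
    of a function with values in the complex numbers or in u + vA. *)
Definition rLp_norm p f : \bar R :=
  ((\int[mu]_(x in D) (f x `^ p)%:E) `^ p^-1)%E.

Lemma integral_powR_ge0 p f : (0 <= \int[mu]_(x in D) (f x `^ p)%:E)%E.
Proof. by apply: integral_ge0 => x _; rewrite lee_fin powR_ge0. Qed.

(** From s + t <= 2 max(s, t), and max(s, t)^p <= s^p + t^p. *)
Lemma powR_le_sum (s t w p C : R) : 1 <= p -> 0 <= C -> 0 <= s -> 0 <= t -> 0 <= w ->
  w <= C * (s + t) -> w `^ p <= (2 * C) `^ p * (s `^ p + t `^ p).
Proof.
move=> p1 C0 s0 t0 w0 wst; have p0 : 0 <= p by rewrite (le_trans _ p1).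
apply: (@le_trans _ _ ((2 * C * Num.max s t) `^ p)).
  apply: ge0_ler_powR => //; rewrite ?nnegrE//.
    by rewrite !mulr_ge0// le_max s0.
  apply: (le_trans wst); rewrite -mulrA mulrCA ler_wpM2l//.
  have : s <= Num.max s t by rewrite le_max lexx.
  have : t <= Num.max s t by rewrite le_max lexx orbT.
  by lra.
rewrite powRM ?mulr_ge0 ?le_max ?s0// ler_wpM2l ?powR_ge0//.
by have [_|_] := leP s t; rewrite ?lerDl ?lerDr powR_ge0.
Qed.

Lemma measurable_powR_comp p f : measurable_fun D f ->
  measurable_fun D (fun x => (f x `^ p)%:E).
Proof.
move=> mf; apply/measurable_EFinP.
exact: (measurableT_comp (measurable_powR p) mf).
Qed.

(** A pointwise bound passes to the norms. The constant is not sharp: one factor 2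
    comes from [powR_le_sum] and the other bounds 2^(1/p). It avoids Minkowski's
    inequality, and any constant independent of the functions gives continuity. *)
Lemma rLp_norm_le p C f g h : 1 <= p -> 0 <= C ->
  measurable_fun D f -> measurable_fun D g -> measurable_fun D h ->
  (forall x, 0 <= f x) -> (forall x, 0 <= g x) -> (forall x, 0 <= h x) ->
  (forall x, f x <= C * (g x + h x)) ->
  (rLp_norm p f <= (4 * C)%:E * maxe (rLp_norm p g) (rLp_norm p h))%E.
Proof.
move=> p1 C0 mf mg mh f0 g0 h0 fgh.
have p0 : 0 < p by rewrite (lt_le_trans _ p1).
have pV0 : 0 <= p^-1 by rewrite invr_ge0 ltW.
have C20 : 0 <= 2 * C by rewrite mulr_ge0.
set I := fun f => (\int[mu]_(x in D) (f x `^ p)%:E)%E.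
have I0 k : (0 <= I k)%E by exact: integral_powR_ge0.
have le1 : (I f <= ((2 * C) `^ p)%:E * (I g + I h))%E.
  rewrite /I -ge0_integralD//; first last.
  - exact: measurable_powR_comp.
  - by move=> x _; rewrite lee_fin powR_ge0.
  - exact: measurable_powR_comp.
  - by move=> x _; rewrite lee_fin powR_ge0.
  rewrite -ge0_integralZl_EFin ?powR_ge0//; first last.
  - by apply: emeasurable_funD; exact: measurable_powR_comp.
  - by move=> x _; rewrite adde_ge0// lee_fin powR_ge0.
  apply: ge0_le_integral => //.
  - by move=> x _; rewrite lee_fin powR_ge0.
  - exact: measurable_powR_comp.
  - apply: emeasurable_funM; first exact: measurable_cst.
    by apply: emeasurable_funD; exact: measurable_powR_comp.
  - by move=> x _; rewrite -EFinD -EFinM lee_fin powR_le_sum.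
have max0 : (0 <= maxe (I g) (I h))%E by rewrite le_max I0.
have le2 : (I f <= ((2 * C) `^ p * 2)%:E * maxe (I g) (I h))%E.
  apply: (le_trans le1); rewrite EFinM -muleA lee_wpmul2l ?lee_fin ?powR_ge0//.
  rewrite [(2%:E)%E](_ : _ = 1%:E + 1%:E)%E// ge0_muleDl ?lee_fin// !mul1e.
  by apply: leeD; rewrite le_max lexx ?orbT.
have K0 : 0 <= (2 * C) `^ p * 2 by rewrite mulr_ge0// powR_ge0.
have itv0 (y : \bar R) : (0 <= y)%E -> y \in `[0%E, +oo%E].
  by move=> y0; rewrite in_itv/= y0 leey.
rewrite /rLp_norm -/(I f) -/(I g) -/(I h).
apply: (@le_trans _ _ ((((2 * C) `^ p * 2)%:E * maxe (I g) (I h)) `^ p^-1)%E).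
  by apply: gt0_ler_poweR => //; apply: itv0 => //; rewrite mule_ge0.
rewrite poweRM ?lee_fin// poweR_EFin; apply: lee_pmul.
- by rewrite lee_fin powR_ge0.
- exact: poweR_ge0.
- rewrite lee_fin powRM ?powR_ge0// -powRrM divff ?gt_eqF// powRr1//.
  have -> : 4 * C = (2 * C) * 2 by lra.
  by rewrite ler_wpM2l// ler1_powR ?ler1n// invf_le1.
- have mono := gt0_ler_poweR pV0.
  have [gh|hg] := leP (I g) (I h).
    by rewrite le_max lexx orbT.
  by rewrite le_max lexx.
Qed.

Lemma rLp_norm_le1 p C f g : 1 <= p -> 0 <= C ->
  measurable_fun D f -> measurable_fun D g ->
  (forall x, 0 <= f x) -> (forall x, 0 <= g x) ->
  (forall x, f x <= C * g x) ->
  (rLp_norm p f <= (4 * C)%:E * rLp_norm p g)%E.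
Proof.
move=> p1 C0 mf mg f0 g0 fg.
have := @rLp_norm_le p C f g g p1 C0 mf mg mg f0 g0 g0; rewrite maxxx; apply.
by move=> x; apply: (le_trans (fg x)); rewrite ler_wpM2l// lerDl.
Qed.

Lemma rLp_norm_ae p f g : measurable_fun D f -> measurable_fun D g ->
  f = g %[ae mu in D] -> rLp_norm p f = rLp_norm p g.
Proof.
move=> mf mg fg; congr (_ `^ _)%E; apply: ge0_ae_eq_integral => //.
- exact: measurable_powR_comp.
- exact: measurable_powR_comp.
- by move=> x _; rewrite lee_fin powR_ge0.
- by move=> x _; rewrite lee_fin powR_ge0.
- by apply: filterS fg => x h Dx; rewrite h.
Qed.

End real_Lp.

Section complex_norms.
Import Normc.
Context {R : realType} {n : nat} (Om : set 'rV[R]_n) (mOm : measurable Om).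
Local Notation leb := (lebesgue_rV n).
Implicit Types (u v : 'rV[R]_n -> R[i]) (c : R[i]) (p : R).

Lemma normc_ge0 (z : R[i]) : 0 <= normc z.
Proof. by case: z => a b; exact: sqrtr_ge0. Qed.

Lemma cmeasurableZD c u v : cmeasurable Om u -> cmeasurable Om v ->
  cmeasurable Om (fun x => c * u x + v x).
Proof.
move=> [u1 u2] [v1 v2]; split.
- apply: (@eq_measurable_fun _ _ _ _ _ (fun x =>
      complex.Re c * re u x - complex.Im c * im u x + re v x)).
    by move=> x _; rewrite /re /im complexReD complexReM.
  by apply: measurable_funD => //; apply: measurable_funB; exact: measurable_funM.
- apply: (@eq_measurable_fun _ _ _ _ _ (fun x =>
      complex.Re c * im u x + complex.Im c * re u x + im v x)).
    by move=> x _; rewrite /re /im complexImD complexImM.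
  by apply: measurable_funD => //; apply: measurable_funD; exact: measurable_funM.
Qed.

Lemma measurable_normc u : cmeasurable Om u -> measurable_fun Om (fun x => normc (u x)).
Proof.
move=> [u1 u2]; apply: (@eq_measurable_fun _ _ _ _ _ (fun x =>
    Num.sqrt (re u x ^+ 2 + im u x ^+ 2))).
  by move=> x _; rewrite /re /im; case: (u x).
apply: (@measurableT_comp _ _ _ _ _ _ (@Num.sqrt R)).
  by apply: continuous_measurable_fun; exact: sqrt_continuous.
by apply: measurable_funD; exact: measurable_funX.
Qed.

Lemma Lp_normE p u : Lp_norm Om p u = rLp_norm leb Om p (fun x => normc (u x)).
Proof. by []. Qed.

Lemma Lp_linear p c u v : 1 <= p -> Lp Om p u -> Lp Om p v ->
  Lp Om p (fun x => c * u x + v x).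
Proof.
move=> p1 [mu fu] [mv fv]; split; first exact: cmeasurableZD.
have C0 : 0 <= normc c + 1 by rewrite addr_ge0// normc_ge0.
have := @rLp_norm_le _ _ _ leb _ mOm p (normc c + 1) (fun x => normc (c * u x + v x))
  (fun x => normc (u x)) (fun x => normc (v x)) p1 C0
  (measurable_normc (cmeasurableZD c mu mv)) (measurable_normc mu) (measurable_normc mv)
  (fun x => normc_ge0 _) (fun x => normc_ge0 _) (fun x => normc_ge0 _).
rewrite -!Lp_normE => h; apply: le_lt_trans (h _) _.
  move=> x; apply: (le_trans (le_normcD _ _)); rewrite normcM mulrDr mulrDl mul1r mulrDl mul1r.
  have := normc_ge0 (u x); have := mulr_ge0 (normc_ge0 c) (normc_ge0 (v x)).
  by move: (normc c * _) (normc c * _) => s t; lra.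
rewrite lte_mul_pinfty ?lee_fin ?mulr_ge0//.
by rewrite gt_max fu fv.
Qed.

Lemma Lp0 p : 1 <= p -> Lp Om p (fun=> 0).
Proof.
move=> p1; have p0 : p != 0 by rewrite gt_eqF// (lt_le_trans _ p1).
split; first by split; exact: measurable_cst.
rewrite /Lp_norm; under eq_integral do rewrite normc0 powR0//.
by rewrite integral0 poweR0r ?invr_neq0// ltry.
Qed.

End complex_norms.

Section fuzzy_norms.
Import Normc.
Context {R : realType} {A : fuzzy_number R} {hA : asymmetric A}.
Context {n : nat} (Om : set 'rV[R]_n) (mOm : measurable Om).
Local Notation leb := (lebesgue_rV n).
Local Notation m := ((midpoint A)%:C%C).
Implicit Types (F G : 'rV[R]_n -> CFA hA) (z : CFA hA) (p : R).

(** The pointwise norm of u + vA is at most this multiple of |u| + |v|, and |u| and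
    |v| are at most this multiple of the pointwise norm. *)
Definition norm_const : R := 2 * (1 + normc m).

Lemma norm_const_ge1 : 1 <= norm_const.
Proof. by rewrite /norm_const; have := @normc_ge0 R m; lra. Qed.

Lemma fuzzy_pnormE p z : fuzzy_pnorm p z =
  (normc ((psi_inv z).1 + m * (psi_inv z).2) `^ p + normc (psi_inv z).2 `^ p) `^ p^-1.
Proof. by rewrite /fuzzy_pnorm; case: (psi_inv z). Qed.

Lemma fuzzy_pnorm_ge0 p z : 0 <= fuzzy_pnorm p z.
Proof. by rewrite fuzzy_pnormE powR_ge0. Qed.

Lemma powR_sum_bounds (s t p : R) : 1 <= p -> 0 <= s -> 0 <= t ->
  [/\ s <= (s `^ p + t `^ p) `^ p^-1, t <= (s `^ p + t `^ p) `^ p^-1 &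
      (s `^ p + t `^ p) `^ p^-1 <= 2 * (s + t)].
Proof.
move=> p1 s0 t0; have p0 : 0 < p by rewrite (lt_le_trans _ p1).
have pV0 : 0 <= p^-1 by rewrite invr_ge0 ltW.
have root (w : R) : 0 <= w -> (w `^ p) `^ p^-1 = w.
  by move=> w0; rewrite -powRrM divff ?gt_eqF// powRr1.
have st0 : 0 <= s `^ p + t `^ p by rewrite addr_ge0 ?powR_ge0.
split.
- by rewrite -[leLHS]root//; apply: ge0_ler_powR; rewrite ?nnegrE ?powR_ge0// lerDl powR_ge0.
- by rewrite -[leLHS]root//; apply: ge0_ler_powR; rewrite ?nnegrE ?powR_ge0// lerDr powR_ge0.
rewrite -[leRHS]root ?mulr_ge0 ?addr_ge0//.
apply: ge0_ler_powR; rewrite ?nnegrE ?powR_ge0//.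
rewrite powRM ?addr_ge0//.
apply: (@le_trans _ _ (2 * (s + t) `^ p)).
  have mono (x y : R) : 0 <= x -> 0 <= y -> x `^ p <= (x + y) `^ p.
    move=> x0 y0; apply: ge0_ler_powR; rewrite ?nnegrE ?addr_ge0 ?(ltW p0)//.
    by rewrite lerDl.
  have := mono s t s0 t0; have := mono t s t0 s0; rewrite [t + s]addrC.
  by move: (_ `^ _) (_ `^ _) (_ `^ _) => a b c; lra.
by rewrite ler_wpM2r ?powR_ge0// le1r_powR// ler1n.
Qed.

(** The coordinate u is recovered as (u + m v) - m v. *)
Lemma normc_coords_le p z : 1 <= p ->
  normc (psi_inv z).1 <= norm_const * fuzzy_pnorm p z /\
  normc (psi_inv z).2 <= norm_const * fuzzy_pnorm p z.
Proof.
move=> p1; rewrite fuzzy_pnormE; set u := _.1; set v := _.2.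
have [+ + _] := powR_sum_bounds p1 (normc_ge0 (u + m * v)) (normc_ge0 v).
set N := _ `^ p^-1 => h1 h2.
have N0 : 0 <= N by exact: powR_ge0.
have m0 : 0 <= normc m := normc_ge0 m.
have hu : normc u <= normc (u + m * v) + normc m * normc v.
  have -> : u = u + m * v + - (m * v) by rewrite addrK.
  apply: (le_trans (le_normcD _ _)); rewrite addrK.
  by rewrite normcN normcM.
have h3 : normc m * normc v <= normc m * N by rewrite ler_wpM2l.
have h4 : 0 <= normc m * N by rewrite mulr_ge0.
rewrite /norm_const; split.
  by rewrite mulrDr mulrDl mulr1 -mulrA; lra.
by rewrite mulrDr mulrDl mulr1 -mulrA; lra.
Qed.

Lemma fuzzy_pnorm_le p z : 1 <= p ->
  fuzzy_pnorm p z <= norm_const * (normc (psi_inv z).1 + normc (psi_inv z).2).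
Proof.
move=> p1; rewrite fuzzy_pnormE; set u := _.1; set v := _.2.
have [_ _] := powR_sum_bounds p1 (normc_ge0 (u + m * v)) (normc_ge0 v).
move=> /le_trans; apply; rewrite /norm_const -mulrA ler_pM2l//.
have := le_normcD u (m * v); rewrite normcM mulrDl mul1r mulrDr.
have := mulr_ge0 (normc_ge0 m) (normc_ge0 u).
have := normc_ge0 u; have := normc_ge0 v.
by move: (normc m * _) (normc m * _) => a b; lra.
Qed.

Lemma measurable_fuzzy_pnorm p F : cmeasurable Om (coordu F) -> cmeasurable Om (coordv F) ->
  measurable_fun Om (fun x => fuzzy_pnorm p (F x)).
Proof.
move=> mu mv; under eq_fun do rewrite fuzzy_pnormE.
apply: (measurableT_comp (measurable_powR p^-1)).
apply: measurable_funD; apply: (measurableT_comp (measurable_powR p)).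
  have := measurable_normc (cmeasurableZD m mv mu).
  by under eq_fun do rewrite addrC.
exact: measurable_normc mv.
Qed.

Lemma fuzzy_Lp_normE p F : fuzzy_Lp_norm Om p F = rLp_norm leb Om p (fun x => fuzzy_pnorm p (F x)).
Proof. by []. Qed.

Let C0 : 0 <= norm_const. Proof. exact: le_trans norm_const_ge1. Qed.

Lemma Lp_norm_coordu_le p F : 1 <= p -> cmeasurable Om (coordu F) -> cmeasurable Om (coordv F) ->
  (Lp_norm Om p (coordu F) <= (4 * norm_const)%:E * fuzzy_Lp_norm Om p F)%E.
Proof.
move=> p1 mu mv; rewrite Lp_normE fuzzy_Lp_normE; apply: rLp_norm_le1 => //.
- exact: measurable_normc.
- exact: measurable_fuzzy_pnorm.
- by move=> x; exact: normc_ge0.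
- by move=> x; exact: fuzzy_pnorm_ge0.
- by move=> x; have [] := normc_coords_le (F x) p1.
Qed.

Lemma Lp_norm_coordv_le p F : 1 <= p -> cmeasurable Om (coordu F) -> cmeasurable Om (coordv F) ->
  (Lp_norm Om p (coordv F) <= (4 * norm_const)%:E * fuzzy_Lp_norm Om p F)%E.
Proof.
move=> p1 mu mv; rewrite Lp_normE fuzzy_Lp_normE; apply: rLp_norm_le1 => //.
- exact: measurable_normc.
- exact: measurable_fuzzy_pnorm.
- by move=> x; exact: normc_ge0.
- by move=> x; exact: fuzzy_pnorm_ge0.
- by move=> x; have [] := normc_coords_le (F x) p1.
Qed.

Lemma fuzzy_Lp_norm_le p F : 1 <= p -> cmeasurable Om (coordu F) -> cmeasurable Om (coordv F) ->
  (fuzzy_Lp_norm Om p F <=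
   (4 * norm_const)%:E * maxe (Lp_norm Om p (coordu F)) (Lp_norm Om p (coordv F)))%E.
Proof.
move=> p1 mu mv; rewrite !Lp_normE fuzzy_Lp_normE; apply: rLp_norm_le => //.
- exact: measurable_fuzzy_pnorm.
- exact: measurable_normc.
- exact: measurable_normc.
- by move=> x; exact: fuzzy_pnorm_ge0.
- by move=> x; exact: normc_ge0.
- by move=> x; exact: normc_ge0.
- by move=> x; exact: fuzzy_pnorm_le.
Qed.

Lemma fuzzy_LpP p F : 1 <= p ->
  fuzzy_Lp Om p F <-> Lp Om p (coordu F) /\ Lp Om p (coordv F).
Proof.
move=> p1; have K0 : (0 <= (4 * norm_const)%:E)%E by rewrite lee_fin mulr_ge0.
split=> [[mu mv Fp]|[[mu up] [mv vp]]].
  split; split; [exact: mu| |exact: mv|].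
    by apply: le_lt_trans (Lp_norm_coordu_le p1 mu mv) _; rewrite lte_mul_pinfty.
  by apply: le_lt_trans (Lp_norm_coordv_le p1 mu mv) _; rewrite lte_mul_pinfty.
split; [exact: mu|exact: mv|]; apply: le_lt_trans (fuzzy_Lp_norm_le p1 mu mv) _.
by rewrite lte_mul_pinfty// gt_max up vp.
Qed.

End fuzzy_norms.
Arguments norm_const {R} A.
Arguments norm_const_ge1 {R} A.

(** * The map Psi on classes *)

Section Psi_linear.
Context {R : realType} {A : fuzzy_number R} {hA : asymmetric A}.
Context {n : nat} (Om : set 'rV[R]_n).
Local Notation leb := (lebesgue_rV n).
Implicit Types (x y z : ae_class Om (CFA hA)) (q : ae_class Om R[i] * ae_class Om R[i]).

Lemma Psi_linear (l : R[i]) x y :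
  Psi Om hA (l *: x + y) = l *: Psi Om hA x + Psi Om hA y.
Proof.
have -> : l *: x + y = to_class Om (l *: repr x + repr y).
  by rewrite to_class_is_linear !to_class_repr.
rewrite PsiE; congr pair; rewrite -to_class_is_linear; congr to_class; apply/funext => t.
  by rewrite /coordu !fctE psi_inv_linear.
by rewrite /coordv !fctE psi_inv_linear.
Qed.

Lemma PsiB x y : Psi Om hA (x - y) = Psi Om hA x - Psi Om hA y.
Proof. by rewrite addrC -scaleN1r Psi_linear scaleN1r addrC. Qed.

Lemma Psi_inj : injective (Psi Om hA).
Proof.
move=> x y; rewrite -(to_class_repr x) -(to_class_repr y) !PsiE => -[].
move=> /to_classP h1 /to_classP h2; apply/to_classP.
apply: filterS2 h1 h2 => t e1 e2 Ot; apply: (can_inj psi_invK).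
by rewrite [LHS]surjective_pairing [RHS]surjective_pairing; congr pair; [exact: e1|exact: e2].
Qed.

Definition Psi_inv q : ae_class Om (CFA hA) :=
  to_class Om (fun t => psi (repr q.1 t, repr q.2 t)).

Lemma Psi_invK : cancel Psi_inv (Psi Om hA).
Proof.
by move=> [a b]; rewrite /Psi_inv PsiE coordu_psi coordv_psi /= !to_class_repr.
Qed.

Lemma PsiK : cancel (Psi Om hA) Psi_inv.
Proof. by move=> x; apply: Psi_inj; rewrite Psi_invK. Qed.

End Psi_linear.
Arguments Psi_inv {R A} hA {n Om} q.

(** * Sobolev spaces *)

Section sobolev_spaces.
Context {R : realType} {n : nat} (Om : set 'rV[R]_n) (oOm : open Om).
Context (k : nat) (p : R) (p1 : 1 <= p).
Local Notation leb := (lebesgue_rV n).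
Implicit Types (u v g h : 'rV[R]_n -> R[i]) (al : 'I_n -> nat).

Let mOm : measurable Om := open_measurable_rV oOm.

Lemma sobolev0 : sobolev Om k p (fun=> 0).
Proof.
split; first exact: Lp0.
by move=> al _; exists (fun=> 0); [exact: weak_derivative0|exact: Lp0].
Qed.

Lemma sobolev_linear c u v : sobolev Om k p u -> sobolev Om k p v ->
  sobolev Om k p (fun x => c * u x + v x).
Proof.
move=> [Lu wu] [Lv wv]; split; first exact: Lp_linear.
move=> al alk; have [g ug Lg] := wu al alk; have [h vh Lh] := wv al alk.
exists (fun x => c * g x + h x); first exact: weak_derivative_linear.
exact: Lp_linear.
Qed.

Lemma Wkp_submod : Wkp Om k p 0 /\
  forall (l : R[i]) x y, Wkp Om k p x -> Wkp Om k p y -> Wkp Om k p (l *: x + y).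
Proof.
split; first by exists (fun=> 0); [exact: sobolev0|].
move=> l _ _ [u su <-] [v sv <-]; exists (fun x => l * u x + v x).
  exact: sobolev_linear.
by rewrite -to_class_is_linear.
Qed.

(** This makes the Sobolev norm of a class independent of its representative and of
    the choice of the weak derivatives. *)
Lemma Lp_norm_weak_derivative_unique al u v g h : u = v %[ae leb in Om] ->
  is_weak_derivative Om al u g -> is_weak_derivative Om al v h ->
  Lp_norm Om p g = Lp_norm Om p h.
Proof.
move=> uv ug vh; have gh := weak_derivative_unique oOm uv ug vh.
rewrite !Lp_normE; apply: rLp_norm_ae => //.
- by apply: measurable_normc; apply: (L1loc_cmeasurable oOm); case: ug.
- by apply: measurable_normc; apply: (L1loc_cmeasurable oOm); case: vh.
- by apply: filterS gh => x /[apply] ->.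
Qed.

End sobolev_spaces.

(** * The isomorphism *)

Section isomorphism.
Context {R : realType} {A : fuzzy_number R} {hA : asymmetric A}.
Context {n : nat} (Om : set 'rV[R]_n) (oOm : open Om).
Context (k : nat) (p : R) (p1 : 1 <= p).
Local Notation leb := (lebesgue_rV n).
Implicit Types (F G : 'rV[R]_n -> CFA hA) (al : 'I_n -> nat).
Implicit Types (z : ae_class Om (CFA hA)).

Let mOm : measurable Om := open_measurable_rV oOm.

Lemma fuzzy_sobolevP F : fuzzy_sobolev Om k p F <->
  sobolev Om k p (coordu F) /\ sobolev Om k p (coordv F).
Proof.
split=> [[LF wF]|[[Lu wu] [Lv wv]]].
  have [Lu Lv] := (fuzzy_LpP mOm F p1).1 LF.
  split; split => // al /wF[G /(fuzzy_weak_derivativeP oOm)[wu wv] /(fuzzy_LpP mOm _ p1)[gu gv]].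
    by exists (coordu G).
  by exists (coordv G).
split; first exact: (fuzzy_LpP mOm F p1).2.
move=> al alk; have [gu ugu Lgu] := wu al alk; have [gv vgv Lgv] := wv al alk.
exists (fun t => psi (gu t, gv t)).
  by apply/(fuzzy_weak_derivativeP oOm); rewrite coordu_psi coordv_psi.
by apply: (fuzzy_LpP mOm _ p1).2; rewrite coordu_psi coordv_psi.
Qed.

(** A representative of z belongs to the fuzzy Sobolev set exactly when its two
    coordinates belong to the complex one; injectivity of Psi brings this back to
    classes. *)
Lemma fuzzy_WkpP z : fuzzy_Wkp Om hA k p z <-> (Wkp Om k p `*` Wkp Om k p) (Psi Om hA z).
Proof.
split=> [[F /fuzzy_sobolevP[su sv] <-]|[/= [u su uE] [v sv vE]]].
  by rewrite PsiE; split; [exists (coordu F)|exists (coordv F)].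
exists (fun t => psi (u t, v t)).
  by apply/fuzzy_sobolevP; rewrite coordu_psi coordv_psi.
by apply: Psi_inj; rewrite PsiE coordu_psi coordv_psi uE vE.
Qed.

Lemma representativeP (V : lmodType R[i]) (W : set ('rV[R]_n -> V)) (q : ae_class Om V) :
  (to_class Om @` W) q -> W (representative W q) /\ to_class Om (representative W q) = q.
Proof.
move=> [F WF Fq]; pose P := [set F | W F /\ to_class Om F = q].
by apply: (@xgetPex _ 0 P); exists F.
Qed.

Definition Wkp_const : R := 4 * norm_const A.

Lemma Wkp_const_gt0 : 0 < Wkp_const.
Proof. by rewrite mulr_gt0// (lt_le_trans _ (norm_const_ge1 A)). Qed.

Lemma fine_le_const (s t : \bar R) : (0 <= s)%E -> (0 <= t)%E -> (t < +oo)%E ->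
  (s <= Wkp_const%:E * t)%E -> fine s <= Wkp_const * fine t.
Proof.
move=> s0 t0 tfin st.
have tf : t \is a fin_num by rewrite ge0_fin_numE.
have sf : s \is a fin_num.
  rewrite ge0_fin_numE//; apply: le_lt_trans st _.
  by rewrite lte_mul_pinfty// lee_fin ltW// Wkp_const_gt0.
by rewrite -lee_fin EFinM !fineK.
Qed.

Lemma fine_le_const_max (s t w : \bar R) : (0 <= s)%E ->
  (0 <= t)%E -> (t < +oo)%E -> (0 <= w)%E -> (w < +oo)%E ->
  (s <= Wkp_const%:E * maxe t w)%E -> fine s <= Wkp_const * Num.max (fine t) (fine w).
Proof.
move=> s0 t0 tfin w0 wfin stw.
have -> : Num.max (fine t) (fine w) = fine (maxe t w).
  by rewrite -fine_max ?ge0_fin_numE.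
by apply: fine_le_const; rewrite // ?le_max ?t0// gt_max tfin.
Qed.

(** The functions F, u and v are representatives chosen independently of each other,
    and so are their derivatives G, gu and gv. Uniqueness of weak derivatives
    identifies gu and gv, up to null sets, with the coordinates of G; then the norm
    comparison applies to G. Only some derivative of u and v is assumed to lie in
    L^p, and uniqueness transfers this to gu and gv. *)
Lemma weak_derivative_norms al F G (u v gu gv : 'rV[R]_n -> R[i]) :
  (mdeg al <= k)%N -> sobolev Om k p u -> sobolev Om k p v ->
  u = coordu F %[ae leb in Om] -> v = coordv F %[ae leb in Om] ->
  is_fuzzy_weak_derivative Om al F G ->
  is_weak_derivative Om al u gu -> is_weak_derivative Om al v gv ->
  let M := Num.max (fine (Lp_norm Om p gu)) (fine (Lp_norm Om p gv)) in
  fine (fuzzy_Lp_norm Om p G) <= Wkp_const * M /\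
  M <= Wkp_const * fine (fuzzy_Lp_norm Om p G).
Proof.
move=> alk [_ Su] [_ Sv] uF vF wG wgu wgv M.
have [wGu wGv] := (fuzzy_weak_derivativeP oOm al _ _).1 wG.
have eu := Lp_norm_weak_derivative_unique oOm p uF wgu wGu.
have ev := Lp_norm_weak_derivative_unique oOm p vF wgv wGv.
have fin (w gw : 'rV[R]_n -> R[i]) : is_weak_derivative Om al w gw ->
    (exists2 g, is_weak_derivative Om al w g & Lp Om p g) -> (Lp_norm Om p gw < +oo)%E.
  move=> wgw [g wg [_ Lg]].
  by rewrite (Lp_norm_weak_derivative_unique oOm p (ae_eq_refl _ _ _) wgw wg).
have fu : (Lp_norm Om p gu < +oo)%E := fin _ _ wgu (Su _ alk).
have fv : (Lp_norm Om p gv < +oo)%E := fin _ _ wgv (Sv _ alk).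
have mu : cmeasurable Om (coordu G) by apply: (L1loc_cmeasurable oOm); case: wGu.
have mv : cmeasurable Om (coordv G) by apply: (L1loc_cmeasurable oOm); case: wGv.
have [_ _ fG] : fuzzy_Lp Om p G.
  apply: (fuzzy_LpP mOm G p1).2; split; split; [exact: mu| |exact: mv|].
    by rewrite -eu.
  by rewrite -ev.
have G0 : (0 <= fuzzy_Lp_norm Om p G)%E by exact: poweR_ge0.
have u0 : (0 <= Lp_norm Om p gu)%E by exact: poweR_ge0.
have v0 : (0 <= Lp_norm Om p gv)%E by exact: poweR_ge0.
split.
  apply: (fine_le_const_max G0 u0 fu v0 fv).
  rewrite eu ev; exact: fuzzy_Lp_norm_le.
rewrite /M ge_max; apply/andP; split.
  apply: (fine_le_const u0 G0 fG); rewrite eu; exact: Lp_norm_coordu_le.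
apply: (fine_le_const v0 G0 fG); rewrite ev; exact: Lp_norm_coordv_le.
Qed.

Lemma representative_Psi z : fuzzy_Wkp Om hA k p z ->
  let F := representative (fuzzy_sobolev Om k p) z in
  let u := representative (sobolev Om k p) (Psi Om hA z).1 in
  let v := representative (sobolev Om k p) (Psi Om hA z).2 in
  [/\ fuzzy_sobolev Om k p F, sobolev Om k p u, sobolev Om k p v,
      u = coordu F %[ae leb in Om] & v = coordv F %[ae leb in Om]].
Proof.
move=> Wz; have [SF Fz] := representativeP Wz; have [W1 W2] := (fuzzy_WkpP z).1 Wz.
have [Su uz] := representativeP W1; have [Sv vz] := representativeP W2.
split; [exact: SF|exact: Su|exact: Sv| |]; apply/to_classP.
  by rewrite uz -[in LHS]Fz PsiE.
by rewrite vz -[in LHS]Fz PsiE.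
Qed.

Lemma is_weak_derivative_chosen al (u : 'rV[R]_n -> R[i]) : (mdeg al <= k)%N ->
  sobolev Om k p u -> is_weak_derivative Om al u (weak_derivative Om al u).
Proof.
move=> alk [_ wu]; have [g ug _] := wu al alk.
by apply: (@xgetPex _ 0 [set g | is_weak_derivative Om al u g]); exists g.
Qed.

Lemma is_fuzzy_weak_derivative_chosen al F : (mdeg al <= k)%N ->
  fuzzy_sobolev Om k p F ->
  is_fuzzy_weak_derivative Om al F (fuzzy_weak_derivative Om al F).
Proof.
move=> alk [_ wF]; have [G FG _] := wF al alk.
by apply: (@xgetPex _ 0 [set G | is_fuzzy_weak_derivative Om al F G]); exists G.
Qed.

Lemma Psi_norm_bounds z : fuzzy_Wkp Om hA k p z ->
  Wkp_pair_norm Om k p (Psi Om hA z) <= Wkp_const * fuzzy_Wkp_norm Om hA k p z /\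
  fuzzy_Wkp_norm Om hA k p z <= Wkp_const * Wkp_pair_norm Om k p (Psi Om hA z).
Proof.
move=> Wz; rewrite /Wkp_pair_norm /mp_norm /fuzzy_Wkp_norm /fuzzy_sobolev_norm !mulr_sumr.
have [SF Su Sv uF vF] := representative_Psi Wz.
split; apply: ler_sum => al alk;
  have [] := weak_derivative_norms alk Su Sv uF vF
    (is_fuzzy_weak_derivative_chosen alk SF)
    (is_weak_derivative_chosen alk Su) (is_weak_derivative_chosen alk Sv);
  by [].
Qed.

Lemma norm_continuous_of_bound (V1 V2 : lmodType R[i]) (W : set V1) (N1 : V1 -> R)
    (N2 : V2 -> R) (f : V1 -> V2) (C : R) : 0 < C ->
  (forall x y, W x -> W y -> N2 (f y - f x) <= C * N1 (y - x)) ->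
  Defs.norm_continuous W N1 N2 f.
Proof.
move=> C0 h x Wx e e0; exists (e / C); first exact: divr_gt0.
move=> y Wy; rewrite ltr_pdivlMr// mulrC => N1e.
exact: le_lt_trans (h _ _ Wx Wy) N1e.
Qed.

Lemma fuzzy_Wkp_submod : fuzzy_Wkp Om hA k p 0 /\
  forall (l : R[i]) x y, fuzzy_Wkp Om hA k p x -> fuzzy_Wkp Om hA k p y ->
    fuzzy_Wkp Om hA k p (l *: x + y).
Proof.
have [W0 WD] := Wkp_submod oOm k p1.
split; first by apply/fuzzy_WkpP; rewrite -[0](subrr 0) PsiB subrr.
move=> l x y /fuzzy_WkpP[x1 x2] /fuzzy_WkpP[y1 y2]; apply/fuzzy_WkpP.
by rewrite Psi_linear; split; apply: WD.
Qed.

Lemma fuzzy_WkpB x y : fuzzy_Wkp Om hA k p x -> fuzzy_Wkp Om hA k p y ->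
  fuzzy_Wkp Om hA k p (y - x).
Proof.
by move=> Wx Wy; rewrite addrC -scaleN1r; have [_] := fuzzy_Wkp_submod; apply.
Qed.

Lemma Psi_homeomorphism : homeomorphism_on
  (fuzzy_Wkp Om hA k p) (Wkp Om k p `*` Wkp Om k p)
  (fuzzy_Wkp_norm Om hA k p) (Wkp_pair_norm Om k p) (Psi Om hA).
Proof.
split.
- split; first by move=> z /fuzzy_WkpP.
  + by move=> x y _ _; exact: Psi_inj.
  + move=> q Wq; exists (Psi_inv hA q); last exact: Psi_invK.
    by apply/fuzzy_WkpP; rewrite Psi_invK.
- apply: (norm_continuous_of_bound Wkp_const_gt0) => x y Wx Wy; rewrite -PsiB.
  by have [] := Psi_norm_bounds (fuzzy_WkpB Wx Wy).
- exists (@Psi_inv _ _ hA _ Om); first by move=> x _; exact: PsiK.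
  apply: (norm_continuous_of_bound Wkp_const_gt0) => x y Wx Wy.
  have WI q : (Wkp Om k p `*` Wkp Om k p) q -> fuzzy_Wkp Om hA k p (Psi_inv hA q).
    by move=> Wq; apply/fuzzy_WkpP; rewrite Psi_invK.
  have [_] := Psi_norm_bounds (fuzzy_WkpB (WI _ Wx) (WI _ Wy)).
  by rewrite PsiB !Psi_invK.
Qed.

End isomorphism.

Theorem theorem4p10 (R : realType) (A : fuzzy_number R) (hA : asymmetric A)
    (n k : nat) (Om : set 'rV[R]_n) (hOm : open Om) (p : R) (hp : 1 <= p) :
  [/\ submod_closed (mem (fuzzy_Wkp Om hA k p)),
      submod_closed (mem (Wkp Om k p `*` Wkp Om k p)),
      linear_homeomorphism
        (fuzzy_Wkp Om hA k p) (Wkp Om k p `*` Wkp Om k p)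
        (fuzzy_Wkp_norm Om hA k p) (Wkp_pair_norm Om k p)
        (Psi Om hA),
      isomorphic
        (fuzzy_Wkp Om hA k p) (Wkp Om k p `*` Wkp Om k p) &
      homeomorphic
        (fuzzy_Wkp Om hA k p) (Wkp Om k p `*` Wkp Om k p)
        (fuzzy_Wkp_norm Om hA k p) (Wkp_pair_norm Om k p)].
Proof.
have homeo := Psi_homeomorphism (hA := hA) hOm k hp.
have lin : linear_on (fuzzy_Wkp Om hA k p) (Psi Om hA).
  by move=> l x y _ _; exact: Psi_linear.
have [F0 FD] := fuzzy_Wkp_submod (hA := hA) hOm k hp.
have [W0 WD] := Wkp_submod hOm k hp.
split.
- split; first by rewrite inE.
  by move=> l x y; rewrite !inE; exact: FD.
- split; first by rewrite inE; split.
  by move=> l x y; rewrite !inE => -[x1 x2] [y1 y2]; split; apply: WD.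
- by split.
- by exists (Psi Om hA); split => //; have [] := homeo.
- by exists (Psi Om hA).
Qed.
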